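(* Let $(l_1,\dots,l_m)$ be the (non-increasing) segment sequence of some unicyclic graph with $l_1\leq 2$, and let $H\in \mathbb{U}(l_1,\dots,l_m)$. (i) If $l_1=2$ and $m\geq 4$, then $n(H)\leq n(U_{l_1,l_2}(l_3,\dots,l_{m-1};l_m))$. (ii) If $l_1=1$ and $m\geq 6$, then $n(H)\leq n(U^1_m)$.
   Context: A unicyclic graph is a connected graph containing exactly one cycle. A segment of a graph $G$ is a path whose end vertices each have degree $1$ or at least $3$ in $G$ and whose internal vertices all have degree $2$ in $G$; its length is its number of edges. The segment sequence of $G$ is the non-increasing sequence of segment lengths of $G$, and $\mathbb{U}(l_1,\dots,l_m)$ is the set of unicyclic graphs with segment sequence $(l_1,\dots,l_m)$. A pendent path of length $\ell$ attached at a vertex $w$ consists of $\ell$ new vertices $x_1,\dots,x_\ell$ and edges $wx_1,x_1x_2,\dots,x_{\ell-1}x_\ell$. For positive integers $a,b$ with $a+b\ge 3$ and lists $s_1,\dots,s_t$ and $r_1,\dots,r_q$ (both nonempty), $U_{a,b}(s_1,\dots,s_t;r_1,\dots,r_q)$ is the graph obtained from the cycle $C_{a+b}$ by choosing two vertices $x,y$ that split the cycle into two paths of lengths $a$ and $b$, attaching pendent paths of lengths $s_1,\dots,s_t$ at $x$ and pendent paths of lengths $r_1,\dots,r_q$ at $y$ (so that its segment sequence consists of $a,b,s_1,\dots,s_t,r_1,\dots,r_q$). $U^1_n$ is the graph obtained from the triangle $C_3$ by attaching one pendent vertex to each of two of its vertices and $n-5$ pendent vertices to the third vertex. A subtree of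 a graph is a subgraph that is a tree (distinguished as subgraphs); $n(G)$ is the number of subtrees of $G$, counting also the empty subtree.
   Formalization: The two ends of a segment may coincide, so a cycle with exactly one vertex of degree at least 3 counts as a segment; with strict paths the claim fails, e.g. for a triangle with six pendent vertices attached at one vertex. *)

(* Defs.v *)
From mathcomp Require Import all_boot.
Set Implicit Arguments. Unset Strict Implicit. Unset Printing Implicit Defensive.

Definition adjE (T : finType) (E : {set {set T}}) : rel T :=
  fun x y => [set x; y] \in E.

Definition simple_graph (T : finType) (E : {set {set T}}) : Prop :=
  forall e, e \in E -> #|e| = 2.

Definition deg (T : finType) (E : {set {set T}}) (v : T) : nat :=
  #|[set e in E | v \in e]|.

Definition connectedG (T : finType) (E : {set {set T}}) : Prop :=
  forall x y : T, connect (adjE E) x y.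

Definition walk_edges (T : finType) (x : T) (s : seq T) : seq {set T} :=
  [seq [set p.1; p.2] | p <- zip (x :: s) s].

Definition cycle_edges (T : finType) (c : seq T) : seq {set T} :=
  match c with [::] => [::] | x :: s => walk_edges x (rcons s x) end.

Definition is_cycle_of (T : finType) (E : {set {set T}}) (C : {set {set T}}) : Prop :=
  exists c : seq T, [/\ 3 <= size c, uniq c, cycle (adjE E) c &
                      C = [set e : {set T} | e \in cycle_edges c]].

Definition unicyclic (T : finType) (E : {set {set T}}) : Prop :=
  connectedG E /\ exists! C, is_cycle_of E C.

(* F is (the edge set of) a segment: a walk x = v_0, ..., v_k (k >= 1)
   with pairwise distinct edges, internal vertices distinct from each other
   and from the end vertices, internal vertices of degree 2, end vertices of
   degree 1 or >= 3 (the two ends may coincide). Its length is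
   k = #|F|. *)
Definition is_segment (T : finType) (E : {set {set T}}) (F : {set {set T}}) : Prop :=
  exists (x : T) (s : seq T),
    0 < size s /\ path (adjE E) x s /\ uniq (belast x s) /\ uniq s /\
    uniq (walk_edges x s) /\
    all (fun v => deg E v == 2) (behead (belast x s)) /\
    ((deg E x == 1) || (2 < deg E x)) /\
    ((deg E (last x s) == 1) || (2 < deg E (last x s))) /\
    F = [set e : {set T} | e \in walk_edges x s].

Definition segseq (T : finType) (E : {set {set T}}) (l : seq nat) : Prop :=
  sorted geq l /\
  exists Fs : seq {set {set T}},
    [/\ uniq Fs, (forall F : {set {set T}}, F \in Fs <-> is_segment E F) &
        perm_eq l (map (fun F : {set {set T}} => #|F|) Fs)].

Definition has_cycle (T : finType) (r : rel T) : bool :=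
  [exists k : 'I_#|T|.+1, exists t : k.-tuple T,
     (2 < k) && uniq t && cycle r t].

Definition is_subtree (T : finType) (E : {set {set T}})
    (p : {set T} * {set {set T}}) : bool :=
  let: (V, F) := p in
  [&& V != set0, F \subset E, [forall e in F, e \subset V],
      [forall x in V, forall y in V, connect (adjE F) x y] &
      ~~ has_cycle (adjE F)].

(* n(G): number of subtrees, counting the empty subtree *)
Definition nsub (T : finType) (E : {set {set T}}) : nat :=
  #|[set p | is_subtree E p]|.+1.

Definition graph_of (N : nat) (ps : seq (nat * nat)) : {set {set 'I_N}} :=
  [set e : {set 'I_N} | [exists i : 'I_N, exists j : 'I_N,
                          (e == [set i; j]) && ((val i, val j) \in ps)]].

Definition cycle_list (n : nat) : seq (nat * nat) :=
  [seq (i, i.+1 %% n) | i <- iota 0 n].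

(* pendent path of length l at w using new vertices k, ..., k+l-1 *)
Definition path_list (w k l : nat) : seq (nat * nat) :=
  [seq (if i == 0 then w else k + i - 1, k + i) | i <- iota 0 l].

Fixpoint pend_list (w k : nat) (ls : seq nat) : seq (nat * nat) :=
  match ls with
  | [::] => [::]
  | l :: ls' => path_list w k l ++ pend_list w (k + l) ls'
  end.

(* U_{a,b}(s;r): cycle 0..a+b-1, x = 0, y = a *)
Definition Ugraph (a b : nat) (s r : seq nat) :
    {set {set 'I_(a + b + sumn s + sumn r)}} :=
  graph_of (a + b + sumn s + sumn r)
    (cycle_list (a + b) ++ pend_list 0 (a + b) s
       ++ pend_list a (a + b + sumn s) r).

Definition U1 (n : nat) : {set {set 'I_n}} :=
  graph_of n ([:: (0, 1); (1, 2); (2, 0); (0, 3); (1, 4)]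
                ++ [seq (2, k) | k <- iota 5 (n - 5)]).

(* Main.v *)
Require Import Defs.
From mathcomp Require Import all_boot.
From mathcomp Require Import zify.

(** Let [c1] and [c2] count the core segments of lengths 1 and 2. Attaching a segment leaves
    [F / (2^c1 * 3^c2)] and [K - c1 - 3 * c2] unchanged, so the final bound depends only on the
    segment sequence and on these two invariants of the core. The extremal cores have ratio 8/9 (a
    4-cycle with pendent edges at opposite vertices), 22/27 (the same with pendent paths of length
    2), 5/6 (a triangle with two pendent edges) and 17/32 (a triangle with three); these are the
    constants of the numerical lemmas. A long bare cycle has a small ratio but a large second
    invariant, so cores are compared through [F] and [F + K].

    A bare core may be too generous: the bound lets every segment be attached at one vertex,
    although each branch vertex of the cycle must carry one. With two branch vertices the bare ratio
    is 1 for the triangle and 10/9 for the 4-cycle; without segments of length 2 it is 3/4 and 5/8.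
    In each of these cases the bare ratio exceeds the extremal one, and segments are forced onto the
    branch vertices first. *)

(** A subtree through a vertex z of a graph with a pendent path of length l at w
    restricts to a subtree through z of the rest, in at most l+1 ways. So when a
    unicyclic graph is grown from a core (its cycle, or the cycle with one pendent
    segment at some of its branch vertices) by adding pendent segments one at a
    time, the number F of subtrees through the best vertex is multiplied by at
    most l+1 at each step, while the remaining subtrees, counted by K, increase by
    l(l+1)/2. Equality holds throughout when all segments are attached at one
    vertex of maximal F, which is what happens in the extremal graphs; it remains
    to compare the values (F, K) of the cores. A bare cycle of length L has L^2
    nonempty subtrees, its arcs, and L(L+1)/2 of them pass through a given vertex;
    with at least three branch vertices (five in part (ii)) this is already good
    enough, and the few shorter cycles are enumerated with the pendent segments
    that their branch vertices must carry. *)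

Set Implicit Arguments. Unset Strict Implicit. Unset Printing Implicit Defensive.

(** * Adding and deleting leaves *)


Lemma connect_map (T T' : finType) (r : rel T) (r' : rel T') (h : T -> T') :
  (forall x y, r x y -> connect r' (h x) (h y)) ->
  forall x y, connect r x y -> connect r' (h x) (h y).
Proof.
move=> H x y /connectP[p]; elim: p x => [|z p IH] x /=; first by move=> _ ->.
case/andP=> /H xz pz yE; exact: connect_trans xz (IH _ pz yE).
Qed.

Lemma connect_closed_set (T : finType) (r : rel T) (A : {set T}) (x y : T) :
  (forall u v, u \in A -> r u v -> v \in A) -> x \in A -> connect r x y -> y \in A.
Proof.
move=> H xA /connectP[p]; elim: p x xA => [|z p IH] x xA /=; first by move=> _ ->.
by case/andP=> /(H _ _ xA) zA pz yE; apply: IH zA pz yE.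
Qed.

Lemma has_cycleP (T : finType) (r : rel T) :
  reflect (exists c : seq T, [/\ 2 < size c, uniq c & cycle r c]) (has_cycle r).
Proof.
apply: (iffP existsP) => [[k /existsP[t /andP[/andP[k2 Ut] Ct]]]|[c [c2 Uc Cc]]].
  by exists t; rewrite size_tuple.
have sc : size c < #|T|.+1 by rewrite ltnS -(card_uniqP Uc) max_card.
exists (Ordinal sc); apply/existsP; exists (in_tuple c).
by rewrite /= c2 Uc.
Qed.

Lemma set2_eqr (T : finType) (u w x : T) :
  ([set u; x] == [set u; w]) = (x == w).
Proof.
apply/eqP/eqP => [E|->//].
have: x \in [set u; w] by rewrite -E !inE eqxx orbT.
have: w \in [set u; x] by rewrite E !inE eqxx orbT.
by rewrite !inE => /orP[]/eqP-> // /orP[]/eqP->.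
Qed.

Lemma adjE_sym (T : finType) (E : {set {set T}}) : symmetric (adjE E).
Proof. by move=> x y; rewrite /adjE setUC. Qed.

Arguments is_subtree : simpl never.

Section Leaves.

Variable (T : finType) (E : {set {set T}}).
Implicit Types (V W Z : {set T}) (F : {set {set T}}).

Lemma is_subtreeP V F :
  reflect [/\ V != set0, F \subset E, (forall e, e \in F -> e \subset V),
              (forall x y, x \in V -> y \in V -> connect (adjE F) x y) &
              ~~ has_cycle (adjE F)] (is_subtree E (V, F)).
Proof.
apply: (iffP and5P) => [[V0 FE /forall_inP FV Vc Fa]|[V0 FE FV Vc Fa]]; split => //.
- by move=> x y xV yV; exact: (forall_inP (forall_inP Vc x xV) y yV).
- exact/forall_inP.
- by apply/forall_inP => x xV; apply/forall_inP => y yV; exact: Vc.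
Qed.

(** A cycle through the new vertex [u] would have [w] as both neighbours of [u]. *)
Lemma subtree_add_leaf V F u w :
  is_subtree E (V, F) -> w \in V -> u \notin V -> [set u; w] \in E ->
  is_subtree E (u |: V, [set u; w] |: F).
Proof.
move=> /is_subtreeP[V0 FE FV Vc Fa] wV uV uwE.
have uw : u != w by apply: contraNneq uV => ->.
apply/is_subtreeP; split.
- by apply/set0Pn; exists u; rewrite !inE eqxx.
- by rewrite subUset sub1set uwE.
- move=> e /setU1P[->|/FV eV]; last exact: subset_trans eV (subsetU1 _ _).
  by apply/subsetP => x; rewrite !inE => /orP[]/eqP->; rewrite ?eqxx ?wV ?orbT.
- have wc x : x \in u |: V -> connect (adjE ([set u; w] |: F)) x w.
    case/setU1P=> [->|xV]; first by apply: connect1; rewrite /adjE !inE eqxx.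
    apply: connect_sub (Vc _ _ xV wV) => y z yz.
    by apply: connect1; rewrite /adjE !inE [_ \in F]yz orbT.
  move=> x y xV yV; apply: connect_trans (wc _ xV) _.
  by rewrite (sym_connect_sym (adjE_sym _)) wc.
- apply: contra Fa => /has_cycleP[c [c2 Uc Cc]]; apply/has_cycleP.
  have adju x : adjE ([set u; w] |: F) u x -> x = w.
    rewrite /adjE !inE set2_eqr => /orP[/eqP//|/FV/subsetP/(_ u)].
    by rewrite !inE eqxx (negPf uV) => /(_ isT).
  case: (boolP (u \in c)) => uc; last first.
    exists c; split=> //; apply: (sub_in_cycle (P := predC1 u)) Cc.
    - move=> x y /= xu yu; rewrite /adjE !inE => /orP[|//].
      move=> /eqP /setP /(_ u); rewrite !inE eqxx /= => /esym.
      by rewrite !(eq_sym u) (negPf (xu : x != u)) (negPf (yu : y != u)).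
    - by apply/allP => x xc /=; apply: contraNneq uc => <-.
  have [i s cE] := rot_to uc.
  move: c2 Uc Cc; rewrite -(size_rot i) -(rot_uniq i) -(rot_cycle i) cE.
  case: s {cE} => [//|x [|y s] //] _ /= /andP[_ /andP[xs _]].
  rewrite rcons_path => /and4P[/adju xw _ _].
  rewrite adjE_sym => /adju lw; move: xs; rewrite xw -lw.
  by rewrite mem_last.
Qed.

Lemma subtree_del_leaf V F u w x :
  is_subtree E (V, F) -> u \in V -> x \in V -> x != u -> u != w ->
  (forall e, e \in F -> u \in e -> e = [set u; w]) ->
  [/\ [set u; w] \in F, w \in V & is_subtree E (V :\ u, F :\ [set u; w])].
Proof.
move=> /is_subtreeP[V0 FE FV Vc Fa] uV xV xu uw Fu.
have uwF : [set u; w] \in F.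
  have /connectP[[|y p] /=] := Vc _ _ uV xV; first by move=> _ /eqP; rewrite (negPf xu).
  case/andP=> uy _ _; have := Fu _ uy; rewrite !inE eqxx => /(_ isT) E1.
  by rewrite -E1.
have wV : w \in V by apply: (subsetP (FV _ uwF)); rewrite !inE eqxx orbT.
split=> //; apply/is_subtreeP; split.
- by apply/set0Pn; exists x; rewrite !inE xu.
- exact: subset_trans (subsetDl _ _) FE.
- move=> e /setD1P[eN eF]; rewrite subsetD1 FV //=.
  by apply: contra eN => ue; rewrite (Fu _ eF ue).
(* Collapsing the leaf onto its neighbour carries every connection in [F] to one that avoids the
   deleted edge. *)
- pose h z := if z == u then w else z.
  have hc y z : adjE F y z -> connect (adjE (F :\ [set u; w])) (h y) (h z).
    move=> yz; rewrite /h; case: (eqVneq y u) => yu; case: (eqVneq z u) => zu //.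
    + have := Fu _ yz; rewrite yu !inE eqxx => /(_ isT) /eqP.
      by rewrite set2_eqr => /eqP->.
    + have := Fu _ yz; rewrite zu !inE eqxx orbT setUC => /(_ isT) /eqP.
      by rewrite set2_eqr => /eqP->.
    + apply: connect1; rewrite /adjE !inE [_ \in F]yz andbT.
      apply/eqP => /setP/(_ u); rewrite !inE eqxx /=.
      by rewrite !(eq_sym u) (negPf yu) (negPf zu).
  move=> y z /setD1P[yu yV] /setD1P[zu zV].
  have := connect_map hc (Vc _ _ yV zV).
  by rewrite /h (negPf yu) (negPf zu).
- apply: contra Fa => /has_cycleP[c [c2 Uc Cc]]; apply/has_cycleP; exists c.
  split=> //; apply: sub_cycle Cc => y z.
  by rewrite /adjE !inE => /andP[].
Qed.

(** [W] is the part of the graph built so far. General [Z], not only singletons, are needed because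
    attaching a path at [w] brings in the count for [w |: Z]. *)
Definition subtrees W Z : {set {set T} * {set {set T}}} :=
  [set p | [&& is_subtree E p, p.1 \subset W & Z \subset p.1]].

Definition cnt W Z := #|subtrees W Z|.

Lemma nsub_cnt : nsub E = (cnt setT set0).+1.
Proof.
rewrite /nsub /cnt; congr (_.+1); apply: eq_card => p.
by rewrite !inE subsetT sub0set !andbT.
Qed.

Lemma cnt_mono W Z Z' : Z' \subset Z -> cnt W Z <= cnt W Z'.
Proof.
move=> ZZ; apply/subset_leq_card/subsetP => p; rewrite !inE => /and3P[-> -> Zp].
exact: subset_trans ZZ Zp.
Qed.

(** Only the neighbours of [u] inside [W] are restricted, so that [u] may receive further vertices
    later. *)
Definition pend W u w :=
  [/\ u \notin W, w \in W & forall v, v \in W -> ([set u; v] \in E) = (v == w)].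

Hypothesis simpE : simple_graph E.

Lemma loopN u : [set u; u] \notin E.
Proof. by apply/negP => /simpE; rewrite setUid cards1. Qed.

Lemma edge_ends e u : e \in E -> u \in e -> exists2 v, v != u & e = [set u; v].
Proof.
move=> /simpE /eqP /cards2P[x [y [xy ->]]]; rewrite !inE => /orP[]/eqP->.
  by exists y; rewrite // eq_sym.
by exists x; rewrite // setUC.
Qed.

Lemma pend_edge W u w e : pend W u w -> e \in E -> e \subset u |: W -> u \in e ->
  e = [set u; w].
Proof.
move=> [uW wW nb] eE eW ue; have [v vu eE'] := edge_ends eE ue.
rewrite eE' in eE eW *; congr [set _; _]; apply/eqP.
have vW : v \in W.
  have := subsetP eW v; rewrite !inE eqxx orbT (negPf vu) => /(_ isT) //.
by rewrite -(nb _ vW).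
Qed.

(** Deleting the leaf [u] is inverse to adding it. The one-vertex tree at [u] is set aside because
    it is the only tree containing [u] but not [w]. *)
Lemma subtrees_pend W Z u w : pend W u w -> Z \subset W ->
  [set p in subtrees (u |: W) (u |: Z) | p.1 != [set u]] =
  [set (u |: p.1, [set u; w] |: p.2) | p in subtrees W (w |: Z)].
Proof.
move=> P ZW; have [uW wW nb] := P.
have uw : u != w by apply: contraNneq uW => ->.
apply/setP => -[V F]; apply/idP/imsetP.
  rewrite !inE /= => /andP[/and3P[st VW ZV] V1].
  have uV : u \in V by apply: (subsetP ZV); rewrite !inE eqxx.
  have [x xV xu] : exists2 x, x \in V & x != u.
    have : ~~ (V \subset [set u]).
      apply: contra V1 => Vu; rewrite eqEsubset Vu /=.
      by apply/subsetP => y; rewrite inE => /eqP->.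
    by case/subsetPn=> x xV; rewrite inE => xu; exists x.
  have [_ FE FV _ _] := is_subtreeP _ _ st.
  have Fu e : e \in F -> u \in e -> e = [set u; w].
    move=> eF; apply: pend_edge P (subsetP FE _ eF) (subset_trans (FV _ eF) VW).
  have [uwF wV st'] := subtree_del_leaf st uV xV xu uw Fu.
  exists (V :\ u, F :\ [set u; w]); last by rewrite /= !setD1K.
  rewrite inE st' /= subUset sub1set !inE wV eq_sym uw /= subsetD1.
  rewrite (contra (subsetP ZW u) uW) andbT (subset_trans (subsetU1 _ _) ZV) andbT.
  by apply/subsetP => y /setD1P[yu] /(subsetP VW); rewrite !inE (negPf yu).
case=> -[V' F'] H [-> ->]; move: H.
rewrite !inE /= subUset sub1set => /and4P[st VW wV ZV].
have uV : u \notin V' by apply: contra uW; apply: (subsetP VW).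
rewrite (subtree_add_leaf st) // ?nb //= !setUS //=; apply/eqP => /setP/(_ w); rewrite !inE wV orbT.
by rewrite eq_sym (negPf uw).
Qed.

Lemma card_subtrees_pend W Z u w : pend W u w -> Z \subset W ->
  #|[set p in subtrees (u |: W) (u |: Z) | p.1 != [set u]]| = cnt W (w |: Z).
Proof.
move=> P ZW; rewrite (subtrees_pend P ZW) card_in_imset // => -[V F] [V' F'].
have [uW _ _] := P.
rewrite !inE /= => /and3P[/is_subtreeP[_ _ FV _ _] VW _].
move=> /and3P[/is_subtreeP[_ _ FV' _ _] VW' _] [VE FE].
have uV : u \notin V by apply: contra uW; apply: (subsetP VW).
have uV' : u \notin V' by apply: contra uW; apply: (subsetP VW').
have uF : [set u; w] \notin F.
  by apply: contra uV => /FV/subsetP; apply; rewrite !inE eqxx.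
have uF' : [set u; w] \notin F'.
  by apply: contra uV' => /FV'/subsetP; apply; rewrite !inE eqxx.
by rewrite -(setU1K uV) VE (setU1K uV') -(setU1K uF) FE (setU1K uF').
Qed.

(** A nonempty [Z] in [W] excludes the one-vertex tree at [u]; for empty [Z] that tree is the extra
    1 in [cnt_pend_new0]. *)
Lemma cnt_pend_new W Z u w : pend W u w -> Z \subset W -> Z != set0 ->
  cnt (u |: W) (u |: Z) = cnt W (w |: Z).
Proof.
move=> P ZW Z0; rewrite -(card_subtrees_pend P ZW) /cnt; apply: eq_card => p.
rewrite !inE; case: and3P => // -[_ _ Zp] /=; symmetry.
have [uW _ _] := P; have [z zZ] := set0Pn _ Z0.
apply/eqP => p1; have := subsetP Zp z; rewrite p1 !inE zZ orbT => /(_ isT) /eqP zu.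
by move: uW; rewrite -zu (subsetP ZW).
Qed.

Lemma subtree1 u : is_subtree E ([set u], set0).
Proof.
apply/is_subtreeP; split; rewrite ?sub0set //.
- by apply/set0Pn; exists u; rewrite inE.
- by move=> e; rewrite inE.
- by move=> x y; rewrite !inE => /eqP-> /eqP->.
- by apply/has_cycleP => -[[|x [|y c]] []] //= _ _; rewrite /adjE inE.
Qed.

Lemma subtree_set1 u F : is_subtree E ([set u], F) -> F = set0.
Proof.
move=> /is_subtreeP[_ FE FV _ _]; apply/eqP; rewrite -subset0; apply/subsetP => e eF.
have := subset_leq_card (FV _ eF); rewrite cards1.
by rewrite (simpE (subsetP FE _ eF)).
Qed.

Lemma cnt_pend_new0 W u w : pend W u w -> cnt (u |: W) [set u] = (cnt W [set w]).+1.
Proof.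
move=> P; rewrite -[[set u]]setU0 -[[set w]]setU0 -(card_subtrees_pend P (sub0set W)).
rewrite /cnt (cardsD1 ([set u], set0)) !inE /= subtree1 setU0 subxx sub1set setU11 /=.
rewrite add1n; congr (_.+1); apply: eq_card => -[V F]; rewrite !inE /= xpair_eqE.
case: (eqVneq V [set u]) => [->|_] //=; last by rewrite andbT.
rewrite andbF; case: eqP => //= F0; apply/negP => /andP[/subtree_set1 //].
Qed.

Lemma cnt_split W Z u : u \notin W -> u \notin Z ->
  cnt (u |: W) Z = cnt W Z + cnt (u |: W) (u |: Z).
Proof.
move=> uW uZ; rewrite /cnt -(cardsID [set p : {set T} * {set {set T}} | u \in p.1]) addnC.
congr (_ + _); apply: eq_card => p; rewrite !inE /=.
- case: (boolP (u \in p.1)) => up; rewrite ?andbT ?andbF /=.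
    rewrite [p.1 \subset W](_ : _ = false) ?andbF //.
    by apply/negP => /subsetP/(_ u up); rewrite (negPf uW).
  congr [&& _, _ & _].
  apply/idP/idP => [|H]; last exact: subset_trans H (subsetU1 _ _).
  move=> /subsetP H; apply/subsetP => x xp; have := H x xp.
  by rewrite !inE => /orP[/eqP xu|//]; rewrite xu (negPf up) in xp.
- by rewrite subUset sub1set; case: (u \in p.1); rewrite ?andbF ?andbT.
Qed.

Lemma cnt_pend W Z u w : pend W u w -> Z \subset W -> Z != set0 ->
  cnt (u |: W) Z = cnt W Z + cnt W (w |: Z).
Proof.
move=> P ZW Z0; have [uW _ _] := P.
by rewrite cnt_split ?(cnt_pend_new P) // (contra (subsetP ZW u)).
Qed.

Lemma cnt_pend0 W u w : pend W u w ->
  cnt (u |: W) set0 = cnt W set0 + (cnt W [set w]).+1.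
Proof.
move=> P; have [uW _ _] := P.
by rewrite cnt_split ?inE // setU0 (cnt_pend_new0 P).
Qed.

End Leaves.

(** * Pendent segments and cycles *)


Section Attach.

Variable (T : finType) (E : {set {set T}}).
Implicit Types (W Z : {set T}).
Hypothesis simpE : simple_graph E.

(** No segment is longer than 2, so two constructors suffice; the path grows one vertex at a time,
    and each new vertex is a leaf of the part before it. *)
Inductive attach W w : nat -> {set T} -> Prop :=
| Attach1 u of pend E W u w : attach W w 1 (u |: W)
| Attach2 u t of pend E W u w & pend E (u |: W) t u : attach W w 2 (t |: (u |: W)).

Lemma attach_sub W w l W' : attach W w l W' -> W \subset W'.
Proof.
case=> [u _|u t _ _]; first exact: subsetU1.
exact: subset_trans (subsetU1 _ _) (subsetU1 _ _).
Qed.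

Lemma attach_mem W w l W' : attach W w l W' -> w \in W.
Proof. by case=> [u []|u t []]. Qed.

(** A tree meeting [W] enters the new path only through [w], and then contains one of its [l]
    nonempty initial parts. *)
Lemma attach_cnt W w l W' Z : attach W w l W' -> Z \subset W -> Z != set0 ->
  cnt E W' Z = cnt E W Z + l * cnt E W (w |: Z).
Proof.
case=> [u P|u t P P2] ZW Z0; first by rewrite (cnt_pend simpE P) // mul1n.
rewrite (cnt_pend simpE P2) ?(subset_trans ZW (subsetU1 _ _)) //.
by rewrite (cnt_pend simpE P) // (cnt_pend_new simpE P) // mul2n -addnn addnA.
Qed.

(* [l.*2.-1] is l(l+1)/2 for l = 1, 2. *)
Lemma attach_cnt0 W w l W' : attach W w l W' ->
  cnt E W' set0 = cnt E W set0 + l * cnt E W [set w] + l.*2.-1.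
Proof.
case=> [u P|u t P P2]; first by rewrite (cnt_pend0 simpE P); lia.
by rewrite (cnt_pend0 simpE P2) (cnt_pend0 simpE P) (cnt_pend_new0 simpE P); lia.
Qed.

(** A tree that contains a new vertex and meets [W] must contain [w]. *)
Lemma attach_new W w l W' Z z : attach W w l W' -> z \in W' -> z \notin W ->
  Z \subset W -> Z != set0 -> cnt E W' (z |: Z) <= cnt E W' (w |: Z).
Proof.
move=> A zW' zW ZW Z0; have wW := attach_mem A.
rewrite (attach_cnt (Z := w |: Z) A); first last.
- by apply/set0Pn; exists w; rewrite setU11.
- by rewrite subUset sub1set wW.
rewrite setUA setUid; case: A zW' => [u P|u t P P2].
  case/setU1P=> [->|zW2]; last by rewrite zW2 in zW.
  by rewrite (cnt_pend_new simpE P) //; lia.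
have Z1 : Z \subset u |: W by apply: subset_trans ZW (subsetU1 _ _).
case/setU1P=> [->|/setU1P[->|zW2]]; last by rewrite zW2 in zW.
  by rewrite (cnt_pend_new simpE P2) // (cnt_pend_new simpE P) //; lia.
rewrite (cnt_pend simpE P2) ?subUset ?sub1set ?setU11 //; last first.
  by apply/set0Pn; exists u; rewrite setU11.
by rewrite setUA setUid (cnt_pend_new simpE P) //; lia.
Qed.

(** Here trees inside the new path count too. The tightest case is the inner vertex of a path of
    length 2, which needs [2 * (F + 1) <= 3 * F], hence [1 < F]. *)
Lemma attach_new0 W w l W' z F : attach W w l W' -> z \in W' -> z \notin W ->
  1 < F -> cnt E W [set w] <= F -> cnt E W' [set z] <= l.+1 * F.
Proof.
move=> A zW' zW F1 wF; case: A zW' => [u P|u t P P2].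
  case/setU1P=> [->|zW2]; last by rewrite zW2 in zW.
  by rewrite (cnt_pend_new0 simpE P) //; lia.
case/setU1P=> [->|/setU1P[->|zW2]]; last by rewrite zW2 in zW.
  by rewrite (cnt_pend_new0 simpE P2) (cnt_pend_new0 simpE P); lia.
rewrite (cnt_pend simpE P2) ?sub1set ?setU11 //; last first.
  by apply/set0Pn; exists u; rewrite inE.
by rewrite setUid (cnt_pend_new0 simpE P) //; lia.
Qed.

End Attach.

(** * Subtrees of a chordless cycle are its arcs *)

Section Cycles.

Variable (T : finType) (E : {set {set T}}).
Hypothesis simpE : simple_graph E.

(* [v] is read modulo [L], so that arcs may wrap around; the last clause also says
   that the cycle has no chord. *)
Definition cyc_enum L (v : nat -> T) :=
  [/\ 2 < L, (forall i j, (v i == v j) = (i == j %[mod L])) &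
      forall i j, ([set v i; v j] \in E) =
                  (j == i.+1 %[mod L]) || (i == j.+1 %[mod L])].

Definition cyc_set L (v : nat -> T) : {set T} := [set v (val i) | i : 'I_L].

(** Built leaf by leaf, so that [subtree_add_leaf] applies to it. *)
Fixpoint arc (v : nat -> T) i j : {set T} * {set {set T}} :=
  if j is j'.+1 then
    (v (i + j) |: (arc v i j').1, [set v (i + j); v (i + j')] |: (arc v i j').2)
  else ([set v i], set0).

Lemma arc1P v i j x : reflect (exists2 k, k <= j & x = v (i + k)) (x \in (arc v i j).1).
Proof.
elim: j => [|j IH] /=.
  rewrite inE; apply: (iffP eqP) => [->|[k]]; first by exists 0; rewrite ?addn0.
  by rewrite leqn0 => /eqP-> ->; rewrite addn0.
apply: (iffP setU1P) => [[->|/IH[k kj ->]]|[k kj xE]].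
- by exists j.+1.
- by exists k => //; apply: leqW.
- move: kj; rewrite leq_eqVlt => /orP[/eqP kj|kj]; [left | right].
    by rewrite xE kj.
  by apply/IH; exists k.
Qed.

Lemma arc2P v i j e : reflect (exists2 k, k < j & e = [set v (i + k); v (i + k).+1])
  (e \in (arc v i j).2).
Proof.
elim: j => [|j IH] /=; first by rewrite inE; constructor => -[].
apply: (iffP setU1P) => [[->|/IH[k kj ->]]|[k kj eE]].
- by exists j; rewrite // setUC addnS.
- by exists k => //; apply: leqW.
- move: kj; rewrite ltnS leq_eqVlt => /orP[/eqP kj|kj]; [left | right].
    by rewrite eE kj setUC addnS.
  by apply/IH; exists k.
Qed.

Variables (L : nat) (v : nat -> T).
Hypothesis cv : cyc_enum L v.

Lemma cyc_gt2 : 2 < L. Proof. by case: cv. Qed.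

Lemma cyc_eq i j : (v i == v j) = (i == j %[mod L]).
Proof. by case: cv => _ ->. Qed.

Lemma cyc_adj i j : ([set v i; v j] \in E) = (v j == v i.+1) || (v i == v j.+1).
Proof. by case: cv => _ H ->; rewrite !H. Qed.

Lemma cyc_modE i : v i = v (i %% L).
Proof. by apply/eqP; rewrite cyc_eq modn_mod. Qed.

Lemma cyc_addL i n : v (i + n * L) = v i.
Proof. by apply/eqP; rewrite cyc_eq addnC modnMDl. Qed.

Lemma cyc_eqD i j k : (v (i + j) == v (i + k)) = (v j == v k).
Proof. by rewrite !cyc_eq eqn_modDl. Qed.

Lemma cyc_eqS j k : (v j.+1 == v k.+1) = (v j == v k).
Proof. exact: cyc_eqD 1 j k. Qed.

Lemma cyc_eq_small i j : i < L -> j < L -> (v i == v j) = (i == j).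
Proof. by move=> iL jL; rewrite cyc_eq !modn_small. Qed.

Lemma cyc_setP x : reflect (exists i, x = v i) (x \in cyc_set L v).
Proof.
have L0 : 0 < L by apply: ltn_trans cyc_gt2.
apply: (iffP imsetP) => [[i _ ->]|[i ->]]; first by exists i.
by exists (Ordinal (ltn_pmod i L0)) => //=; rewrite -cyc_modE.
Qed.

Lemma mem_cyc i : v i \in cyc_set L v.
Proof. by apply/cyc_setP; exists i. Qed.

Lemma card_cyc : #|cyc_set L v| = L.
Proof.
rewrite /cyc_set card_imset ?card_ord // => i j /eqP.
by rewrite cyc_eq_small ?ltn_ord // => /eqP /val_inj.
Qed.

Lemma arc_subtree i j : j < L -> is_subtree E (arc v i j).
Proof.
elim: j => [|j IH] jL; first exact: subtree1.
rewrite /=; have := IH (ltnW jL); move: (arc1P v i j).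
case: (arc v i j) => V F /= VP st.
apply: (subtree_add_leaf st).
- by apply/VP; exists j.
- apply/VP => -[k kj] /eqP; rewrite cyc_eqD cyc_eq_small //; last by lia.
  by lia.
- by rewrite setUC cyc_adj addnS eqxx.
Qed.

Lemma arc_mod i i' j : v i = v i' -> arc v i j = arc v i' j.
Proof.
move=> ii; have ek k : v (i + k) = v (i' + k).
  by apply/eqP; rewrite !(addnC _ k) cyc_eqD ii.
by elim: j => [|j IH] /=; rewrite ?ii // !ek IH.
Qed.

Lemma cycle_mkseq (r : rel T) : (forall i, r (v i) (v i.+1)) -> cycle r (mkseq v L).
Proof.
move=> rv; have pth n a : path r (v a) (map v (iota a.+1 n)).
  by elim: n a => //= n IH a; rewrite rv IH.
have aux n : v n.+1 = v 0 -> cycle r (mkseq v n.+1).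
  move=> e0; rewrite /mkseq /= -[X in rcons _ X]e0 -map_rcons.
  have -> : rcons (iota 1 n) n.+1 = iota 1 n.+1.
    by rewrite -cats1 -[n.+1 in RHS]addn1 iotaD add1n.
  exact: pth.
have L2 := cyc_gt2; rewrite -(ltn_predK L2); apply: aux.
by rewrite (ltn_predK L2); apply/eqP; rewrite cyc_eq modnn mod0n.
Qed.

Lemma uniq_mkseq_cyc : uniq (mkseq v L).
Proof.
rewrite /mkseq map_inj_in_uniq ?iota_uniq // => i j; rewrite !mem_iota !add0n => iL jL.
by move=> /eqP; rewrite cyc_eq_small // => /eqP.
Qed.

Lemma subtree_arc V F : is_subtree E (V, F) -> V \subset cyc_set L v ->
  exists i j, [/\ i < L, j < L & (V, F) = arc v i j].
Proof.
move=> st VC; have [V0 FE FV Vc Fa] := is_subtreeP _ _ _ st.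
have L0 : 0 < L by apply: ltn_trans cyc_gt2.
have FVl x y : [set x; y] \in F -> x \in V.
  by move=> /FV/subsetP; apply; rewrite !inE eqxx.
have FVr x y : [set x; y] \in F -> y \in V by rewrite setUC; apply: FVl.
(* The first vertex of the arc: a vertex of the tree whose preceding cycle edge is missing. Without
   one, [F] would contain the whole cycle. *)
have [i vV iF] : exists2 i, v i.+1 \in V & [set v i; v i.+1] \notin F.
  case: (boolP [exists i : 'I_L, (v i.+1 \in V) && ([set v i; v i.+1] \notin F)]).
    by case/existsP=> i /andP[]; exists (val i).
  rewrite negb_exists => /forallP H; exfalso.
  have H1 i : v i.+1 \in V -> [set v i; v i.+1] \in F.
    have := H (Ordinal (ltn_pmod i L0)); rewrite /= negb_and negbK.
    rewrite -cyc_modE.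
    suff -> : v (i %% L).+1 = v i.+1 by case/orP=> // /negPf->.
    by apply/eqP; rewrite cyc_eqS -cyc_modE.
  have [x xV] := set0Pn _ V0; have /cyc_setP[i0 xE] := subsetP VC _ xV.
  have bw n k : v (n + k) \in V -> v n \in V.
    elim: k => [|k IH]; rewrite ?addn0 // addnS => /H1 /FVl; exact: IH.
  have all_V n : v n \in V.
    (* The index [i0 + n * L] also names [x] and is at least [n], so walking back from it reaches
       [v n]. *)
    apply: (bw n (i0 + n * L - n)).
    have -> : n + (i0 + n * L - n) = i0 + n * L.
      by rewrite subnKC //; apply: leq_trans (leq_addl _ _); rewrite leq_pmulr.
    by rewrite cyc_addL -xE.
  case/negP: Fa; apply/has_cycleP; exists (mkseq v L).
  rewrite size_mkseq cyc_gt2 uniq_mkseq_cyc; split=> //.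
  by apply: cycle_mkseq => n; apply: H1; apply: all_V.
set s := i.+1 in vV iF.
(* Going forward from [s], the walk stops at the latest at the missing edge before [s]; the first
   missing edge gives the length of the arc. *)
have exk : exists k, [set v (s + k); v (s + k).+1] \notin F.
  exists L.-1; have -> : s + L.-1 = i + 1 * L by rewrite /s; lia.
  have -> : (i + 1 * L).+1 = s + 1 * L by rewrite /s; lia.
  by rewrite !cyc_addL.
case: (ex_minnP exk) => j jF jmin.
have jL : j < L.
  suff : j <= L.-1 by lia.
  apply: jmin; have -> : s + L.-1 = i + 1 * L by rewrite /s; lia.
  have -> : (i + 1 * L).+1 = s + 1 * L by rewrite /s; lia.
  by rewrite !cyc_addL.
have inF k : k < j -> [set v (s + k); v (s + k).+1] \in F.
  by move=> kj; apply: contraLR kj => /jmin; rewrite -leqNgt.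
have V'V k : k <= j -> v (s + k) \in V.
  by case: k => [|k] kj; rewrite ?addn0 // addnS; apply: FVr (inF _ kj).
have step k y : k <= j -> [set v (s + k); y] \in F ->
    (k < j /\ y = v (s + k).+1) \/ (0 < k /\ y = v (s + k.-1)).
  move=> kj yF; have /cyc_setP[m yE] := subsetP VC _ (FVr _ _ yF).
  have := subsetP FE _ yF; rewrite {1}yE cyc_adj -yE => /orP[/eqP yE'|].
    left; split=> //; rewrite ltn_neqAle kj andbT; apply: contraNneq jF => <-.
    by rewrite -yE'.
  case: k kj yF => [|k] kj yF.
    rewrite addn0 cyc_eqS => /eqP im; case/negP: iF.
    by move: yF; rewrite addn0 yE -im setUC.
  by rewrite addnS cyc_eqS yE => /eqP <-; right.
have VE : V = (arc v s j).1.
  apply/eqP; rewrite eqEsubset; apply/andP; split; apply/subsetP => x.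
    move=> xV; apply: (connect_closed_set _ _ (Vc _ _ vV xV)); last first.
      by apply/arc1P; exists 0; rewrite ?addn0.
    move=> a b /arc1P[k kj ->] /(step _ _ kj)[[kj' ->]|[k0 ->]]; apply/arc1P.
      by exists k.+1; rewrite ?addnS.
    by exists k.-1 => //; lia.
  by case/arc1P=> k kj ->; apply: V'V.
have FE' : F = (arc v s j).2.
  apply/eqP; rewrite eqEsubset; apply/andP; split; apply/subsetP => e; last first.
    by case/arc2P=> k kj ->; apply: inF.
  move=> eF; have /eqP/cards2P[x [y [_ eE]]] := simpE (subsetP FE _ eF).
  rewrite eE in eF *; have := FVl _ _ eF; rewrite VE => /arc1P[k kj xE].
  apply/arc2P; rewrite xE in eF *; case: (step _ _ kj eF) => -[k0 ->].
    by exists k.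
  by exists k.-1; [lia | rewrite setUC -addnS prednK].
exists (s %% L), j; split=> //; first by rewrite ltn_mod.
by rewrite -(arc_mod j (cyc_modE s)) VE FE'; case: (arc v s j).
Qed.

Lemma card_arc i j : j < L -> #|(arc v i j).1| = j.+1.
Proof.
elim: j => [|j IH] jL /=; first by rewrite cards1.
rewrite cardsU1 IH ?(ltnW jL) //; case: arc1P => //= -[k kj] /eqP.
by rewrite cyc_eqD cyc_eq_small //; lia.
Qed.

(** All arcs with [L - 1] edges have the same vertex set, so the start has to be recognised by the
    edges: no edge of an arc enters its first vertex from behind. *)
Lemma arc_inj i j i' j' : i < L -> j < L -> i' < L -> j' < L ->
  arc v i j = arc v i' j' -> (i = i') * (j = j').
Proof.
move=> iL jL iL' jL' Ea.
have jj : j = j' by have := card_arc i jL; rewrite Ea card_arc // => -[].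
subst j'; split=> //; apply/eqP; rewrite -cyc_eq_small //.
have : v i \in (arc v i' j).1 by rewrite -Ea; apply/arc1P; exists 0; rewrite ?addn0.
case/arc1P=> -[_ ->|k kj iE]; first by rewrite addn0.
have : [set v (i' + k); v i] \in (arc v i' j).2.
  by apply/arc2P; exists k; rewrite // iE addnS.
have L2 := cyc_gt2.
have small a : a < L -> v i = v (i + a) -> a = 0.
  move=> aL /eqP; rewrite -{1}[i]addn0 cyc_eqD cyc_eq_small //; last by lia.
  by move/eqP.
have ik : v i = v (i' + k).+1 by rewrite iE addnS.
rewrite -Ea => /arc2P[k' kj' /setP eE].
have : v i \in [set v (i + k'); v (i + k').+1] by rewrite -eE !inE eqxx orbT.
case/set2P=> [/small k0|]; last by rewrite -addnS => /small; lia.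
have {}k0 : k' = 0 by apply: k0; lia.
have : v (i' + k) \in [set v i; v i.+1] by rewrite -(addn0 i) -k0 -eE !inE eqxx.
case/set2P=> /eqP; rewrite -cyc_eqS -ik => /eqP.
  by rewrite -addn1 => /small; lia.
by rewrite -addn2 => /small; lia.
Qed.

(* The arc with first vertex [v i] and j edges contains [v t] iff (t - i) mod n <= j;
   adding [n - i] avoids a truncated subtraction. *)
Definition arcs_through n (ts : seq nat) : nat :=
  sumn [seq count (fun j => all (fun t => (t + (n - i)) %% n <= j) ts) (iota 0 n)
       | i <- iota 0 n].

Lemma mem_arc t i j : i < L -> j < L ->
  (v t \in (arc v i j).1) = ((t + (L - i)) %% L <= j).
Proof.
move=> iL jL; apply/arc1P/idP => [[k kj /eqP]|H].
  rewrite cyc_eq => /eqP tE.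
  suff -> : (t + (L - i)) %% L = k by [].
  rewrite -modnDml tE modnDml.
  have -> : i + k + (L - i) = k + L by lia.
  by rewrite modnDr modn_small //; lia.
exists ((t + (L - i)) %% L) => //; apply/eqP; rewrite cyc_eq modnDmr.
have -> : i + (t + (L - i)) = t + L by lia.
by rewrite modnDr.
Qed.

Lemma sum_ord_iota n (f : nat -> nat) : \sum_(i < n) f i = sumn [seq f i | i <- iota 0 n].
Proof. by rewrite sumnE big_map -(big_mkord xpredT f) /index_iota subn0. Qed.

(** Makes counts in a cycle of given length closed terms that can be evaluated. *)
Lemma cnt_cyc (Z : {set T}) ts : Z =i map v ts ->
  cnt E (cyc_set L v) Z = arcs_through L ts.
Proof.
move=> Zts; pose X := [set p : 'I_L * 'I_L | Z \subset (arc v p.1 p.2).1].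
have -> : cnt E (cyc_set L v) Z = #|X|.
  rewrite /cnt -(card_imset (mem X) (f := fun p : 'I_L * 'I_L => arc v p.1 p.2)); last first.
    move=> [i j] [i' j'] /= Ea; 
    by have [/val_inj-> /val_inj->] := arc_inj (ltn_ord i) (ltn_ord j) (ltn_ord i') (ltn_ord j') Ea.
  apply: eq_card => -[V F]; apply/idP/imsetP.
    rewrite inE /= => /and3P[st VC ZV].
    have [i [j [iL jL Ea]]] := subtree_arc st VC.
    by exists (Ordinal iL, Ordinal jL); rewrite ?inE /= -Ea.
  case=> -[i j]; rewrite inE /= => Zij Ea.
  rewrite inE /= {1}Ea arc_subtree //=.
  move: Zij; rewrite -Ea /= => ->; rewrite andbT.
  have -> : V = (arc v i j).1 by rewrite -Ea.
  by apply/subsetP => x /arc1P[k _ ->]; rewrite mem_cyc.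
have -> : #|X| = \sum_(i < L) \sum_(j < L) all (fun t => (t + (L - i)) %% L <= j) ts.
  rewrite pair_bigA /= -sum1_card big_mkcond /=; apply: eq_bigr => -[i j] _.
  rewrite inE /= [in RHS](_ : all _ ts = (Z \subset (arc v i j).1)); first by case: (Z \subset _).
  apply/allP/subsetP => [H x|H t tts].
    by rewrite Zts => /mapP[t /H tx ->]; rewrite mem_arc.
  by rewrite -mem_arc //; apply: H; rewrite Zts map_f.
rewrite (sum_ord_iota L (fun i => \sum_(j < L) all (fun t => (t + (L - i)) %% L <= j) ts)).
congr sumn; apply: eq_map => i.
rewrite (sum_ord_iota L (fun j => nat_of_bool (all (fun t => (t + (L - i)) %% L <= j) ts))).
by elim: (iota 0 L) => //= j s ->.
Qed.

Lemma cnt_cyc0 : cnt E (cyc_set L v) set0 = L * L.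
Proof.
rewrite (cnt_cyc (ts := [::])) => [|x]; last by rewrite inE.
rewrite /arcs_through /= (eq_map (g := fun=> L)) => [|i].
  by rewrite -{3}(size_iota 0 L); elim: (iota 0 L) => //= i s ->; rewrite mulSn.
by rewrite (eq_count (a2 := predT)) // count_predT size_iota.
Qed.

Lemma cyc_shift t : cyc_enum L (fun i => v (t + i)).
Proof.
have [L2 ve va] := cv; split=> // i j; first by rewrite ve eqn_modDl.
by rewrite va -!addnS !eqn_modDl.
Qed.

Lemma cyc_set_shift t : cyc_set L (fun i => v (t + i)) = cyc_set L v.
Proof.
have L0 : 0 < L by apply: ltn_trans cyc_gt2.
apply/eqP; rewrite eqEcard card_cyc; apply/andP; split.
  by apply/subsetP => x /imsetP[i _ ->]; rewrite mem_cyc.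
rewrite /cyc_set card_imset ?card_ord // => i j /eqP.
by rewrite cyc_eqD cyc_eq_small ?ltn_ord // => /eqP /val_inj.
Qed.

End Cycles.

Lemma cnt_cyc1 (T : finType) (E : {set {set T}}) L v t :
  simple_graph E -> cyc_enum E L v ->
  (cnt E (cyc_set L v) [set v t]).*2 = L * L.+1.
Proof.
move=> simpE cv; have cv' := cyc_shift cv t.
rewrite -(cyc_set_shift cv t).
rewrite (cnt_cyc simpE cv' (ts := [:: 0])) => [|x]; last by rewrite !inE addn0.
have L2 := cyc_gt2 cv; rewrite /arcs_through.
have cl n m : count (fun j => m <= j) (iota 0 n) = n - m.
  elim: n => [|n IH] //.
  rewrite -addn1 iotaD count_cat IH /= add0n; lia.
(* The number of arcs from [v i] through [v 0] is [L] for [i = 0] and [i] otherwise; their sum is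
   [L + (1 + ... + (L - 1))]. *)
rewrite (eq_map (g := fun i => L - (L - i) %% L)) => [|i]; last first.
  by rewrite -(cl L ((L - i) %% L)); apply: eq_count => j /=; rewrite add0n andbT.
case: L L2 {cv cv'} => // n _.
rewrite /= subn0 modnn subn0.
have -> : [seq n.+1 - (n.+1 - i) %% n.+1 | i <- iota 1 n] = [seq i | i <- iota 1 n].
  by apply/eq_in_map => i; rewrite mem_iota => iL; rewrite modn_small; lia.
rewrite map_id doubleD.
have -> : (sumn (iota 1 n)).*2 = n * n.+1.
  elim: n => [//|n IH].
  have -> : iota 1 n.+1 = iota 1 n ++ [:: n.+1].
    by rewrite -[n.+1 in LHS]addn1 iotaD add1n.
  by rewrite sumn_cat doubleD IH /=; lia.
lia.
Qed.

(** * Growing a unicyclic graph from a core *)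


Arguments walk_edges : simpl never.

Section Walks.

Variable (T : finType).
Implicit Types (E : {set {set T}}) (s : seq T).

Lemma walk_edges_cons (x y : T) s : walk_edges x (y :: s) = [set x; y] :: walk_edges y s.
Proof. by []. Qed.

Lemma walk_edges_rcons (x z : T) s :
  walk_edges x (rcons s z) = rcons (walk_edges x s) [set last x s; z].
Proof. by elim: s x => [|y s IH] x; rewrite // rcons_cons !walk_edges_cons IH. Qed.

Lemma size_walk_edges (x : T) s : size (walk_edges x s) = size s.
Proof. by elim: s x => [|y s IH] x; rewrite // walk_edges_cons /= IH. Qed.

Lemma walk_edgesP (x0 x : T) s e :
  reflect (exists2 i, i < size s & e = [set nth x0 (x :: s) i; nth x0 s i])
          (e \in walk_edges x s).
Proof.
elim: s x => [|y s IH] x; first by constructor => -[].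
rewrite walk_edges_cons; apply: (iffP idP).
  rewrite inE => /orP[/eqP->|/IH[i i_s ->]]; first by exists 0.
  by exists i.+1.
rewrite inE => -[[|i] i_s eE]; first by rewrite eE eqxx.
by apply/orP; right; apply/IH; exists i.
Qed.

(* Otherwise the edge would close a second cycle. *)
Lemma bridge E C0 (x y : T) : unicyclic E -> is_cycle_of E C0 -> x != y ->
  [set x; y] \in E -> connect (adjE (E :\ [set x; y])) x y -> [set x; y] \in C0.
Proof.
move=> [_ [C1 [_ C1u]]] /C1u <- xy xyE /connectP[p]; case/shortenP => p' pp' Up' _ yE.
rewrite (C1u [set e | e \in cycle_edges (x :: p')]).
  by rewrite inE /= walk_edges_rcons mem_rcons inE yE setUC eqxx.
exists (x :: p'); split=> //=.
  case: p' pp' Up' yE => [|z [|z' p']] //=; first by move=> _ _ E1; rewrite E1 eqxx in xy.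
  by rewrite /adjE => /andP[+ _] _ E1; rewrite E1 !inE eqxx.
rewrite rcons_path; apply/andP; split.
  by apply: sub_path pp' => a b; rewrite /adjE !inE => /andP[].
by rewrite -yE /adjE setUC.
Qed.

(** The cycle has no chord: the ends of a chord are also joined along the cycle, so by [bridge] the
    chord would be a cycle edge. *)
Lemma cycle_of_enum E C0 : simple_graph E -> unicyclic E -> is_cycle_of E C0 ->
  exists L v, cyc_enum E L v /\ forall e, e \in C0 -> e \subset cyc_set L v.
Proof.
move=> simpE uE cC0; have [[|x0 s] [c2 Uc Cc C0E]] := cC0; first by [].
pose L := (size s).+1; pose v k := nth x0 (x0 :: s) (k %% L).
have L0 : 0 < L by [].
have vm i : v i = v (i %% L) by rewrite /v modn_mod.
have vS i : v i.+1 = v (i %% L).+1 by rewrite /v -addn1 -modnDml addn1.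
have vv i j : (v i == v j) = (i == j %[mod L]).
  by rewrite /v nth_uniq // ltn_mod.
have nth1 i : i < L -> nth x0 (x0 :: rcons s x0) i = v i.
  by move=> iL; rewrite -rcons_cons nth_rcons /= iL /v modn_small.
have nth2 i : i < L -> nth x0 (rcons s x0) i = v i.+1.
  rewrite /v nth_rcons => iL; case: ltngtP => is'; first by rewrite modn_small.
    by move: iL; rewrite ltnS leqNgt is'.
  by rewrite is' modnn.
have memC0 e : (e \in C0) -> exists i, e = [set v i; v i.+1].
  rewrite C0E inE => /(walk_edgesP x0) [i]; rewrite size_rcons => iL ->.
  by exists i; rewrite nth1 ?nth2.
have C0mem i : [set v i; v i.+1] \in C0.
  have iL := ltn_pmod i L0; rewrite vm vS C0E inE; apply/(walk_edgesP x0).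
  by exists (i %% L); rewrite ?size_rcons // nth1 ?nth2.
have edge i : [set v i; v i.+1] \in E.
  have iL := ltn_pmod i L0; move/(pathP x0)/(_ (i %% L)): Cc.
  by rewrite size_rcons => /(_ iL); rewrite nth1 // nth2 // -vm -vS.
exists L, v; split; last first.
  move=> e /memC0[i ->]; apply/subsetP => x; rewrite !inE => /orP[]/eqP->.
    by rewrite vm; apply/imsetP; exists (Ordinal (ltn_pmod i L0)).
  by rewrite vm; apply/imsetP; exists (Ordinal (ltn_pmod i.+1 L0)).
split=> // i j; rewrite -!vv; apply/idP/idP; last first.
  by case/orP => /eqP->; [exact: edge | rewrite setUC; exact: edge].
move=> ijE; have vij : v i != v j.
  by apply/eqP => vij; move/negP: (loopN simpE (v j)); rewrite -{1}vij.
have : [set v i; v j] \in C0.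
  apply: contraT => ijC; rewrite -(negPf ijC).
  apply: (bridge uE cC0 vij ijE).
  have conn k : connect (adjE (E :\ [set v i; v j])) (v i) (v (i + k)).
    elim: k => [|k IH]; first by rewrite addn0.
    apply: connect_trans IH (connect1 _); rewrite /adjE !inE addnS edge andbT.
    by apply: contraNneq ijC => <-; exact: C0mem.
  (* The index equals [i * L + j]: going round [i] times avoids a subtraction. *)
  have vjE : v (i + (j + i * L.-1)) = v j.
    apply/eqP; rewrite vv.
    have -> : i + (j + i * L.-1) = i * L + j by rewrite /L /=; nia.
    by rewrite modnMDl.
  by rewrite -{2}vjE; exact: conn.
have vS' a b : v a = v b -> v a.+1 = v b.+1.
  by move/eqP; rewrite vv => /eqP ab; apply/eqP; rewrite vv -addn1 -modnDml ab modnDml addn1.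
move/memC0 => [k /setP eE]; have := eE (v i); have := eE (v j).
rewrite !inE !eqxx !orbT => /esym/orP[]/eqP jk /esym/orP[]/eqP ik.
- by rewrite ik jk eqxx in vij.
- by apply/orP; right; rewrite ik (vS' _ _ jk).
- by apply/orP; left; rewrite jk (vS' _ _ ik).
- by rewrite ik jk eqxx in vij.
Qed.

End Walks.

Section Grow.

Variable (T : finType) (E C0 : {set {set T}}) (C D : {set T}).
Hypothesis simpE : simple_graph E.
Hypothesis uE : unicyclic E.
Hypothesis cC0 : is_cycle_of E C0.
Hypothesis C0C : forall e, e \in C0 -> e \subset C.
Hypothesis D2 : forall x, (x \in D) = (deg E x == 2).
Hypothesis Dind : forall x y, x \in D -> y \in D -> [set x; y] \notin E.
Implicit Types (W : {set T}).

Definition induced W : {set {set T}} := [set e in E | e \subset W].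

Definition spanned W :=
  C \subset W /\ forall x y, x \in W -> y \in W -> connect (adjE (induced W)) x y.

(* W is a union of segments: a vertex of degree 2 comes with both its edges. *)
Definition full W := forall x y, x \in W -> x \in D -> [set x; y] \in E -> y \in W.

(** With a second neighbour [x] of [u] in the connected part [W], the edge [ux] would lie on a
    cycle, hence on the unique one, which is inside [W]. *)
Lemma spanned_pend W u w : spanned W -> w \in W -> u \notin W -> [set u; w] \in E ->
  pend E W u w.
Proof.
move=> [CW Wc] wW uW uwE; split=> // x xW; apply/idP/eqP => [uxE|->//].
apply/eqP; apply: contraT => xw; case/negP: (uW); apply: (subsetP CW).
have ux : u != x by apply: contraNneq uW => ->.
suff /C0C/subsetP : [set u; x] \in C0 by apply; rewrite !inE eqxx.
apply: (bridge uE cC0 ux uxE); apply: (@connect_trans _ _ w); first apply: connect1.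
  by rewrite /adjE !inE uwE andbT set2_eqr eq_sym; exact: xw.
apply: connect_sub (Wc _ _ wW xW) => a b; rewrite /adjE inE => /andP[abE abW].
apply: connect1; rewrite !inE abE andbT; apply: contraNneq uW => ab.
by apply: (subsetP abW); rewrite ab !inE eqxx.
Qed.

Lemma induced_pend W u w : pend E W u w -> induced (u |: W) = [set u; w] |: induced W.
Proof.
move=> P; have [uW wW nb] := P; apply/setP => e; rewrite !inE.
case: (boolP (e == [set u; w])) => [/eqP->|eN] /=.
  rewrite nb // eqxx /=; apply/subsetP => x; rewrite !inE => /orP[]/eqP->.
    by rewrite eqxx.
  by rewrite wW orbT.
apply: andb_id2l => eE; apply/idP/idP => eW; last exact: subset_trans eW (subsetU1 _ _).
apply/subsetP => x xe; have := subsetP eW _ xe; rewrite !inE => /orP[/eqP xu|//].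
by rewrite (pend_edge simpE P eE eW) ?eqxx // -xu in eN.
Qed.

Lemma card_induced_pend W u w : pend E W u w -> #|induced (u |: W)| = #|induced W|.+1.
Proof.
move=> P; rewrite (induced_pend P) cardsU1 inE [_ && _](_ : _ = false) //.
apply/negP => /andP[_ /subsetP/(_ u)]; rewrite !inE eqxx => /(_ isT).
by case: P => /negPf->.
Qed.

Lemma spanned_add W u w : spanned W -> pend E W u w -> spanned (u |: W).
Proof.
move=> [CW Wc] P; split; first exact: subset_trans CW (subsetU1 _ _).
have [uW wW _] := P; rewrite (induced_pend P).
have wc x : x \in u |: W -> connect (adjE ([set u; w] |: induced W)) x w.
  case/setU1P=> [->|xW]; first by apply: connect1; rewrite /adjE !inE eqxx.
  apply: connect_sub (Wc _ _ xW wW) => y z yz.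
  by apply: connect1; rewrite /adjE in_setU [_ \in induced W]yz orbT.
move=> x y xV yV; apply: connect_trans (wc _ xV) _.
by rewrite (sym_connect_sym (adjE_sym _)) wc.
Qed.

Lemma deg2_nbr u w : u \in D -> [set u; w] \in E ->
  exists t, [/\ t != w, t != u, [set u; t] \in E &
               forall x, [set u; x] \in E -> x = w \/ x = t].
Proof.
rewrite D2 => /cards2P[a [b [ab sE]]] uwE.
have mem e : (e \in E) && (u \in e) = (e \in [set a; b]) by rewrite -sE !inE.
have [e [eN eE ue]] : exists e, [/\ e != [set u; w], e \in E & u \in e].
  have : [set u; w] \in [set a; b] by rewrite -mem uwE !inE eqxx.
  have /andP[aE ua] : (a \in E) && (u \in a) by rewrite mem !inE eqxx.
  have /andP[bE ub] : (b \in E) && (u \in b) by rewrite mem !inE eqxx orbT.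
  by case/set2P=> ->; [exists b; rewrite eq_sym | exists a].
have [t tu eE'] := edge_ends simpE eE ue; subst e; rewrite set2_eqr in eN.
exists t; split=> // x uxE.
have Es : [set a; b] = [set [set u; w]; [set u; t]].
  apply/esym/eqP; rewrite eqEcard subUset !sub1set -!mem uwE eE !inE eqxx /=.
  by rewrite !cards2 ab set2_eqr eq_sym eN.
have : [set u; x] \in [set a; b] by rewrite -mem uxE !inE eqxx.
by rewrite Es => /set2P[]/eqP; rewrite set2_eqr => /eqP; [left|right].
Qed.

(** The degree of [u] decides the length: if it is 2, the other neighbour [t] is new and not of
    degree 2, so the segment ends there. *)
Lemma attach_exists W w u : spanned W -> full W -> w \in W -> u \notin W ->
  [set u; w] \in E ->
  exists l W', [/\ attach E W w l W', spanned W', full W', u \in W' &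
    [/\ 0 < l <= 2, #|W'| = #|W| + l, #|D :&: W'| = #|D :&: W| + l.-1 &
       #|induced W'| = #|induced W| + l]].
Proof.
move=> sW fW wW uW uwE; have P := spanned_pend sW wW uW uwE.
have sW1 := spanned_add sW P; have [_ _ nb] := P.
case: (boolP (u \in D)) => uD; last first.
  exists 1, (u |: W); split=> //; first exact: Attach1.
  - move=> x y /setU1P[->|xW]; first by rewrite (negPf uD).
    by move=> xD xyE; rewrite !inE (fW _ _ xW xD xyE) orbT.
  - by rewrite !inE eqxx.
  - split=> //; first by rewrite cardsU1 uW addnC.
      rewrite addn0; apply: eq_card => x; rewrite !inE.
      by case: (eqVneq x u) => // ->; rewrite (negPf uD).
    by rewrite (card_induced_pend P) addn1.
have [t [tw tu utE ut_only]] := deg2_nbr uD uwE.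
have tW : t \notin W by apply/negP => tW; have := nb _ tW; rewrite utE (negPf tw).
have tD : t \notin D by apply/negP => tD; move/negP: (Dind uD tD); case.
have P2 : pend E (u |: W) t u.
  apply: spanned_pend => //; rewrite ?setU11 // ?inE ?negb_or ?tu //.
  by rewrite setUC.
exists 2, (t |: (u |: W)); split=> //; first exact: Attach2.
- exact: spanned_add sW1 P2.
- move=> x y; rewrite !inE => /orP[/eqP->|/orP[/eqP->|xW]]; first by rewrite (negPf tD).
    by move=> _ /ut_only[]->; rewrite ?eqxx ?wW ?orbT.
  by move=> xD xyE; rewrite (fW _ _ xW xD xyE) !orbT.
- by rewrite !inE eqxx orbT.
- split=> //; first by rewrite !cardsU1 uW !inE negb_or tu tW; lia.
    have -> : D :&: (t |: (u |: W)) = u |: (D :&: W).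
      apply/setP => x; rewrite !inE; case: (eqVneq x u) => [->|_]; first by rewrite uD orbT.
      by case: (eqVneq x t) => [->|_] //=; rewrite (negPf tD).
    by rewrite cardsU1 !inE (negPf uW) andbF addnC.
  by rewrite (card_induced_pend P2) (card_induced_pend P); lia.
Qed.

Lemma leaving_edge W w0 : connectedG E -> w0 \in W -> W != setT ->
  exists w u, [/\ w \in W, u \notin W & [set u; w] \in E].
Proof.
move=> cE w0W WT; have [u0 u0W] : exists u0, u0 \notin W.
  apply/existsP; rewrite -negb_forall; apply: contra WT => /forallP WT.
  by apply/eqP/setP => x; rewrite inE WT.
case: (boolP [exists w, exists u, [&& w \in W, u \notin W & [set u; w] \in E]]).
  by case/existsP=> w /existsP[u /and3P[]]; exists w, u.
rewrite negb_exists => /forallP H; case/negP: u0W.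
apply: (connect_closed_set _ w0W (cE w0 u0)) => a b aW ab; apply: contraT => bW.
have := H a; rewrite negb_exists => /forallP/(_ b).
by rewrite aW bW setUC [_ \in E]ab.
Qed.

(** Induction on the number of vertices not yet reached, with [F] and [K] general because each step
    passes on [l.+1 * F] and [K + l.*2.-1]. The numbers [a] and [b] count the attached segments of
    lengths 1 and 2. *)
Lemma grow_bound W w0 F K : spanned W -> full W -> w0 \in W -> 1 < F ->
  (forall z, z \in W -> cnt E W [set z] <= F) -> cnt E W set0 <= F + K ->
  exists a b, [/\ #|T| = #|W| + a + b.*2, #|D| = #|D :&: W| + b,
                 #|E| = #|induced W| + a + b.*2 &
                 cnt E setT set0 <= F * 2 ^ a * 3 ^ b + K + a + 3 * b].
Proof.
elim: {W}_.+1 {-2}W (ltnSn #|~: W|) F K => // n IH W Wn F K sW fW wW F1 HF HK.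
case: (eqVneq W setT) => [WT|WT].
  exists 0, 0; rewrite WT in HK *; rewrite cardsT setIT; split; rewrite ?addn0 //.
    by apply: eq_card => e; rewrite inE subsetT andbT.
  by rewrite !muln1.
have [w [u [wW' uW uwE]]] := leaving_edge (proj1 uE) wW WT.
have [l [W' [A sW' fW' uW' [l12 cW cD cI]]]] := attach_exists sW fW wW' uW uwE.
have sub := attach_sub A.
have l0 : 0 < l by case/andP: l12.
have lt : #|~: W'| < n.
  by have := cardsC W; have := cardsC W'; move: Wn l0; rewrite cW; lia.
have F1' : 1 < l.+1 * F by nia.
have HF' z : z \in W' -> cnt E W' [set z] <= l.+1 * F.
  move=> zW'; case: (boolP (z \in W)) => zW; last by apply: (attach_new0 simpE A) => //; exact: HF.
  rewrite (attach_cnt simpE A) ?sub1set //; last by apply/set0Pn; exists z; rewrite inE.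
  (* The trees through both [z] and [w] are at most those through [w], hence at most [F]. *)
  rewrite mulSn leq_add ?HF // leq_mul2l; apply/orP; right.
  apply: leq_trans (HF w wW'); apply: cnt_mono; exact: subsetUl.
have HK' : cnt E W' set0 <= l.+1 * F + (K + l.*2.-1).
  by rewrite (attach_cnt0 simpE A); have := HF w wW'; nia.
have [a [b [e1 e2 e3 e4]]] :=
  IH W' lt _ _ sW' fW' (subsetP sub _ wW) F1' HF' HK'.
case: l l12 {A l0 F1' HF' HK'} cW cD cI e4 => [|[|[|l]]] // _ cW cD cI e4.
  by exists a.+1, b; split; [lia|lia|lia|apply: leq_trans e4 _; rewrite expnS; lia].
by exists a, b.+1; split; [lia|lia|lia|apply: leq_trans e4 _; rewrite expnS; lia].
Qed.

End Grow.

(** * Segments of length at most two *)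


Section Segments.

Variable (T : finType) (E : {set {set T}}).
Hypothesis simpE : simple_graph E.
Implicit Types (s : seq T) (F : {set {set T}}).

Definition star (v : T) : {set {set T}} := [set e in E | v \in e].

Definition D2set : {set T} := [set v | deg E v == 2].

Lemma mem_D2set x : (x \in D2set) = (deg E x == 2).
Proof. by rewrite inE. Qed.

Lemma walk_edges_sub (x : T) s e z : e \in walk_edges x s -> z \in e -> z \in x :: s.
Proof.
elim: s x => [|y s IH] x //; rewrite walk_edges_cons inE => /orP[/eqP->|/IH H /H].
  by rewrite !inE => /orP[]->; rewrite ?orbT.
by rewrite !inE => ->; rewrite orbT.
Qed.

Lemma uniq_walk_edges (x : T) s : uniq (x :: s) -> uniq (walk_edges x s).
Proof.
elim: s x => [|y s IH] x //; rewrite walk_edges_cons => /andP[xs Us].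
rewrite /= IH // andbT; apply: contra xs => /walk_edges_sub; apply.
by rewrite !inE eqxx.
Qed.

(** For segments whose two ends coincide: the edge returning to [a] repeats none of the path. *)
Lemma closing_edgeN (a : T) s : uniq (a :: s) -> 1 < size s ->
  [set last a s; a] \notin walk_edges a s.
Proof.
case: s => [//|b [//|c s]] /= /and3P[aN bN _] _.
rewrite walk_edges_cons inE negb_or; apply/andP; split.
  rewrite setUC set2_eqr; apply: contraNneq bN => <-; exact: mem_last.
by apply: contra aN => /walk_edges_sub; apply; exact: set22.
Qed.

Lemma segment_end x y : [set x; y] \in E -> x \notin D2set ->
  (deg E x == 1) || (2 < deg E x).
Proof.
move=> xyE; rewrite inE => d2.
have : 0 < deg E x by apply/card_gt0P; exists [set x; y]; rewrite !inE xyE eqxx.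
by move: d2; case: (deg E x) => [|[|[|n]]].
Qed.

Lemma deg_end x : (deg E x == 1) || (2 < deg E x) -> x \notin D2set.
Proof. by rewrite inE; case: (deg E x) => [|[|[|n]]]. Qed.

(* Continuing a path of vertices of degree 2 must end at another type of vertex: by
   degrees it can neither stop nor run into itself. *)
Lemma long_segment a s : a \notin D2set -> path (adjE E) a s -> uniq (a :: s) ->
  all (mem D2set) s -> 1 < size s -> exists F, is_segment E F /\ 2 < #|F|.
Proof.
elim: {s}_.+1 {-2}s (ltnSn (#|T| - size s)) => // n IH s.
case/lastP: s => [//|s1 y]; case/lastP: s1 => [//|s2 p].
set s' := rcons (rcons s2 p) y => sn aD pth Us Ds s1.
have yD : y \in D2set by apply: (allP Ds); rewrite mem_rcons mem_head.
have [] : adjE E p y /\ path (adjE E) a (rcons s2 p).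
  by move: pth; rewrite /s' rcons_path last_rcons => /andP[].
rewrite adjE_sym => ypE pth2.
have [c [cp cy ycE yonly]] := deg2_nbr simpE mem_D2set yD ypE.
have pth' : path (adjE E) a (rcons s' c).
  by rewrite rcons_path pth /= /s' last_rcons.
have yN : y \notin a :: rcons s2 p.
  by move: Us; rewrite /s' -rcons_cons rcons_uniq => /andP[].
(* If [c] does not have degree 2, the segment ends there, possibly back at [a]. Otherwise the path
   is prolonged by [c]. *)
case: (boolP (c \in D2set)) => cD; last first.
  have cs : c \notin s' by apply: contra cD => /(allP Ds).
  have Uw : uniq (walk_edges a (rcons s' c)).
    rewrite walk_edges_rcons rcons_uniq uniq_walk_edges // andbT.
    rewrite /s' last_rcons -/s'; apply/negP => yc.
    have /orP[/eqP ca|] : (c == a) || (c \in s').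
      by have := walk_edges_sub yc (set22 _ _); rewrite inE.
    2: by rewrite (negPf cs).
    by rewrite ca in yc; have := closing_edgeN Us s1; rewrite /s' last_rcons -/s' yc.
  exists [set e | e \in walk_edges a (rcons s' c)]; split; last first.
    by rewrite cardsE (card_uniqP Uw) size_walk_edges size_rcons.
  exists a, (rcons s' c); rewrite size_rcons pth' belast_rcons Us rcons_uniq cs Uw.
  rewrite last_rcons; do !split=> //.
  - by have /andP[] : (a \notin s') && uniq s' := Us.
  - by apply/allP => v /= /(allP Ds); rewrite /= inE.
  - case: (s') s1 pth => [|b s3] //= _ /andP[abE _]; exact: segment_end abE aD.
  - by apply: (@segment_end _ y) cD; rewrite setUC.
apply: (IH (rcons s' c)) => //.
- rewrite size_rcons; have : size (a :: s') <= #|T| by rewrite -(card_uniqP Us) max_card.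
  move: sn => /=; move: (size s') #|T|; clear; lia.
- rewrite -rcons_cons rcons_uniq Us andbT inE negb_or.
  rewrite (contraNneq _ aD) => [|<- //] /=.
  rewrite /s' !mem_rcons !inE mem_rcons inE !negb_or cy cp /=.
  (* If [c] were already an inner vertex of the path, its predecessor [q], its successor [z] and [y]
     would be three neighbours. *)
  apply/negP => cs2.
  have [s3 [s4 s2E]] : exists s3 s4, s2 = s3 ++ c :: s4.
    by case/splitPr: cs2 => s3 s4; exists s3, s4.
  rewrite s2E rcons_cat in pth2 yN.
  have [z zN czE] : exists2 z, z \in rcons s4 p & [set c; z] \in E.
    move: pth2; rewrite cat_path /= => /and3P[_ _].
    case: (s4) => [|z s5] /= /andP[czE _]; first by exists p; rewrite ?inE.
    by exists z; rewrite ?mem_head.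
  have [q qN cqE] : exists2 q, q \in a :: s3 & [set c; q] \in E.
    move: pth2; rewrite cat_path /= => /and3P[_ qc _].
    by exists (last a s3); rewrite ?mem_last // setUC.
  have Us2 : uniq ((a :: s3) ++ c :: rcons s4 p).
    move: Us; rewrite /s' -rcons_cons rcons_uniq => /andP[_].
    by rewrite s2E rcons_cat.
  have qz : q != z.
    apply: contraTneq Us2 => qz; rewrite cat_uniq; apply/negP => /and3P[_ /hasP[]].
    by exists z; rewrite -?qz // inE qz zN orbT.
  have [t [_ _ _ conly]] := deg2_nbr simpE mem_D2set cD cqE.
  have zt : z = t by case: (conly _ czE) => // zq; rewrite zq eqxx in qz.
  have ycE' : [set c; y] \in E by rewrite setUC.
  move: yN; rewrite inE mem_cat inE !negb_or => /and4P[ya y3 _ y4].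
  case: (conly _ ycE') => yE; last by rewrite yE -zt zN in y4.
  by move: qN; rewrite -yE inE (negPf ya) (negPf y3).
- by rewrite all_rcons /= cD.
- by rewrite size_rcons ltnS ltnW.
Qed.

(** The vertices of degree 2 with a neighbour of degree 2 form a set closed under adjacency, as a
    neighbour of another degree would start a segment of length at least 3. By connectedness the set
    would contain the end of a segment. The existence of a segment excludes the graph that is just a
    cycle. *)
Lemma deg2_indep : connectedG E -> (exists F, is_segment E F) ->
  (forall F, is_segment E F -> #|F| <= 2) ->
  forall x y, x \in D2set -> y \in D2set -> [set x; y] \notin E.
Proof.
move=> cE [F0 [z [_ [_ [_ [_ [_ [_ [_ [/deg_end zD _]]]]]]]]]] short x y xD yD.
apply/negP => xyE; case/negP: zD.
pose A := [set v in D2set | [exists v' in D2set, [set v; v'] \in E]].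
suff : z \in A by rewrite inE => /andP[].
apply: (connect_closed_set _ _ (cE x z)); last first.
  by rewrite inE xD; apply/existsP; exists y; rewrite yD.
move=> v u; rewrite inE => /andP[vD /existsP[v' /andP[v'D vvE]]] vuE.
have uD : u \in D2set.
  apply: contraT => uD.
  have [|||||F [/short F2]] := @long_segment u [:: v; v'] => //.
  - by rewrite /= adjE_sym vuE /adjE vvE.
  - rewrite /= !inE !negb_or !andbT -andbA; apply/and3P; split.
    + by apply: contraNneq uD => ->.
    + by apply: contraNneq uD => ->.
    + by apply: contraTneq vvE => ->; exact: loopN.
  - by rewrite /= vD v'D.
  - by rewrite ltnNge F2.
by rewrite inE uD; apply/existsP; exists v; rewrite vD setUC.
Qed.

Hypothesis Dind : forall x y, x \in D2set -> y \in D2set -> [set x; y] \notin E.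
Hypothesis short : forall F, is_segment E F -> #|F| <= 2.

Definition free_edges : {set {set T}} := [set e in E | e :&: D2set == set0].

(** A segment of length 2 is determined by its middle vertex, as the pair of edges there. *)
Definition segments : {set {set {set T}}} :=
  [set star v | v in D2set] :|: [set [set e] | e in free_edges].

Lemma card_star v : #|star v| = deg E v.
Proof. by []. Qed.

Lemma segmentsP F : is_segment E F <-> F \in segments.
Proof.
split=> [sF|].
  have := short sF; case: sF => x [s [s0 [pth [_ [_ [Uw [Ds [/deg_end xD [yD ->]]]]]]]]].
  rewrite cardsE (card_uniqP Uw) size_walk_edges.
  case: s s0 pth Uw Ds yD => [|v [|y [|? ?]]] //= _.
    rewrite andbT => xvE _ _ /deg_end vD _.
    apply/setUP; right; apply/imsetP; exists [set x; v]; last first.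
      by apply/setP => e; rewrite !inE.
    rewrite inE [_ \in E]xvE; apply/eqP/setP => u; rewrite [LHS]inE in_set0.
    apply/negP => /andP[/set2P[]->]; first by rewrite (negPf xD).
    by rewrite (negPf vD).
  rewrite !walk_edges_cons => /and3P[xvE vyE _] Uw /andP[/eqP dv _] _ _.
  apply/setUP; left; apply/imsetP; exists v; first by rewrite inE dv.
  apply/eqP; rewrite eqEcard card_star dv cardsE (@card_uniqP _ [:: _; _] Uw) /= andbT.
  apply/subsetP => e; rewrite !inE => /orP[]/eqP->.
    by rewrite [_ \in E]xvE !inE eqxx orbT.
  by rewrite [_ \in E]vyE !inE eqxx.
case/setUP=> /imsetP[].
  move=> v vD ->; have := vD; rewrite inE => /cards2P[e [f [ef sE]]].
  have /andP[eE ve] : (e \in E) && (v \in e).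
    by have := set21 e f; rewrite -sE inE.
  have /andP[fE vf] : (f \in E) && (v \in f).
    by have := set22 e f; rewrite -sE inE.
  have [a av ea] := edge_ends simpE eE ve; have [b bv fb] := edge_ends simpE fE vf.
  have aD : a \notin D2set.
    by apply/negP => aD; move/negP: (Dind vD aD); rewrite -ea.
  have bD : b \notin D2set.
    by apply/negP => bD; move/negP: (Dind vD bD); rewrite -fb.
  have ab : a != b by apply: contraNneq ef => ab; rewrite ea fb ab.
  exists a, [:: v; b]; rewrite /= walk_edges_cons walk_edges_cons !inE.
  have ea' : [set a; v] = e by rewrite setUC.
  rewrite /adjE ea' -fb eE fE av ef (eq_sym v) bv /=.
  rewrite -mem_D2set vD; do !split=> //.
  - by apply: (@segment_end _ v) aD; rewrite ea'.
  - by apply: (@segment_end _ v) bD; rewrite setUC -fb.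
  - by rewrite -/(star v) /star sE; apply/setP => g; rewrite !inE.
move=> e; rewrite inE => /andP[eE /eqP/setP eD] ->.
have /eqP/cards2P[x [y [xy eE']]] := simpE eE; subst e.
have xD : x \notin D2set by have := eD x; rewrite inE set21 in_set0 /= => ->.
have yD : y \notin D2set by have := eD y; rewrite inE set22 in_set0 /= => ->.
exists x, [:: y]; rewrite /= walk_edges_cons /= /adjE eE; do !split=> //.
- exact: segment_end eE xD.
- by apply: (@segment_end _ x) yD; rewrite setUC.
- by apply/setP => g; rewrite !inE.
Qed.

(** Double counting of the incidences with vertices of degree 2: each edge has at most one such
    end. *)
Lemma card_edges : #|E| = #|free_edges| + #|D2set|.*2.
Proof.
have -> : #|D2set|.*2 = \sum_(e in E) #|e :&: D2set|.
  transitivity (\sum_(v in D2set) \sum_(e in E | v \in e) 1).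
    rewrite -muln2 -sum_nat_const; apply: eq_bigr => v; rewrite inE => /eqP <-.
    by rewrite sum1dep_card; apply: eq_card => e; rewrite !inE.
  rewrite (exchange_big_dep (mem E)) /= => [|v e _ /andP[] //].
  apply: eq_bigr => e eE; rewrite sum1dep_card; apply: eq_card => v.
  by rewrite !inE eE andTb andbC.
have -> : #|free_edges| = \sum_(e in E) (e :&: D2set == set0).
  rewrite -sum1_card big_mkcond [RHS]big_mkcond; apply: eq_bigr => e _.
  by rewrite inE; case: (e \in E) => //=; case: eqP.
rewrite -big_split -sum1_card /=; apply: eq_bigr => e eE.
case: eqP => [->|/eqP/set0Pn[x]]; first by rewrite cards0.
rewrite inE => /andP[xe xD]; have [y yx eE'] := edge_ends simpE eE xe.
rewrite (_ : e :&: D2set = [set x]) ?cards1 //; apply/setP => z; rewrite 2!inE eE'.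
apply/andP/eqP => [[/set2P[] // -> yD]|->]; last by rewrite set21.
by move: eE; rewrite eE' (negPf (Dind xD yD)).
Qed.

Lemma segseq_shape l : segseq E l ->
  l = nseq #|D2set| 2 ++ nseq #|free_edges| 1.
Proof.
move=> [sl [Fs [UF memF pl]]].
have star2 v : v \in D2set -> #|star v| = 2 by rewrite inE => /eqP.
have pF : perm_eq Fs (enum [set star v | v in D2set] ++ enum [set [set e] | e in free_edges]).
  apply: uniq_perm => //.
    rewrite cat_uniq !enum_uniq andbT /=; apply/hasPn => F.
    rewrite !mem_enum => /imsetP[e _ ->]; apply/negP => /imsetP[v /star2 c2 E1].
    by move: c2; rewrite -E1 cards1.
  move=> F; rewrite mem_cat !mem_enum -in_setU -/segments.
  by apply/idP/idP; [move/memF/segmentsP | move/segmentsP/memF].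
have c1 : [seq #|F| | F : {set {set T}} <- enum [set star v | v in D2set]] = nseq #|D2set| 2.
  have -> : #|D2set| = #|[set star v | v in D2set]|.
    rewrite card_in_imset // => u v uD vD sE; apply/eqP; apply: contraT => uv.
    have : star u \subset [set [set u; v]].
      apply/subsetP => e eu; have ev := eu; rewrite sE in ev.
      move: eu ev; rewrite !inE => /andP[eE ue] /andP[_ ve].
      have [w _ eE'] := edge_ends simpE eE ue.
      by move: ve; rewrite eE' => /set2P[vu|->] //; rewrite vu eqxx in uv.
    by move/subset_leq_card; rewrite cards1 (star2 _ uD).
  rewrite cardE -(size_map (fun F : {set {set T}} => #|F|)); apply/all_pred1P.
  by apply/allP => k /mapP[F]; rewrite mem_enum => /imsetP[v /star2 c2 ->] ->; rewrite /= c2.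
have c2 : [seq #|F| | F : {set {set T}} <- enum [set [set e] | e in free_edges]] = nseq #|free_edges| 1.
  rewrite -(card_imset (mem free_edges) (@set1_inj _)).
  rewrite cardE -(size_map (fun F : {set {set T}} => #|F|)); apply/all_pred1P.
  by apply/allP => k /mapP[F]; rewrite mem_enum => /imsetP[e _ ->] ->; rewrite /= cards1.
apply: (sorted_eq (leT := geq)) => //.
- by move=> a b c /= ab bc; exact: leq_trans bc ab.
- by move=> a b /= /andP[ab ba]; apply/eqP; rewrite eqn_leq ab ba.
- case: #|D2set| => [|d].
    by case: #|free_edges| => [|n] //=; elim: n.
  by rewrite /=; elim: d => [|d IH] //=; case: #|free_edges| => [|n] //=; elim: n.
by apply: (perm_trans pl); rewrite -c1 -c2 -map_cat perm_map.
Qed.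

End Segments.

(** * Subtrees of the extremal graphs *)


Section Attaches.

Variable (T : finType) (E : {set {set T}}) (w : T).
Hypothesis simpE : simple_graph E.

Inductive attaches : {set T} -> seq nat -> {set T} -> Prop :=
| AttachesNil W : attaches W [::] W
| AttachesCons W l W' ls W'' of attach E W w l W' & attaches W' ls W'' :
    attaches W (l :: ls) W''.

Definition pathprod (ls : seq nat) := foldr (fun l p => l.+1 * p) 1 ls.

Lemma pathprod_gt0 ls : 0 < pathprod ls.
Proof. by elim: ls => //= l ls IH; rewrite muln_gt0. Qed.

Lemma attaches_sub W ls W' : attaches W ls W' -> W \subset W'.
Proof. by elim=> // {}W l {}W' {}ls W'' /attach_sub H _; apply: subset_trans. Qed.

Lemma attaches_cnt W ls W' (Z : {set T}) : attaches W ls W' -> w \in W -> Z \subset W -> Z != set0 ->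
  cnt E W' Z = cnt E W Z + (pathprod ls).-1 * cnt E W (w |: Z).
Proof.
move=> A wW ZW Z0.
(* The count through [w] itself is multiplied at each step and has to be carried along in the
   induction. *)
suff [] : cnt E W' (w |: Z) = pathprod ls * cnt E W (w |: Z) /\
             cnt E W' Z = cnt E W Z + (pathprod ls).-1 * cnt E W (w |: Z) by [].
elim: A wW ZW => {W ls W'} [W|W l W' ls W'' A _ IH] wW ZW.
  by rewrite mul0n addn0 mul1n.
have sub := attach_sub A.
have wZW : w |: Z \subset W by rewrite subUset sub1set wW.
have wZ0 : w |: Z != set0 by apply/set0Pn; exists w; rewrite setU11.
have [-> ->] := IH (subsetP sub _ wW) (subset_trans ZW sub).
rewrite (attach_cnt simpE A wZW wZ0) (attach_cnt simpE A ZW Z0) setUA setUid /=.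
have := pathprod_gt0 ls; move: (pathprod ls) (cnt E W _) (cnt E W Z) => [//|p] x y _.
by split; nia.
Qed.

Lemma attaches_cnt0 W ls W' : attaches W ls W' -> w \in W ->
  cnt E W' set0 = cnt E W set0 + (pathprod ls).-1 * cnt E W [set w] +
                  \sum_(l <- ls) l.*2.-1.
Proof.
elim=> {W ls W'} [W|W l W' ls W'' A _ IH] wW.
  by rewrite big_nil mul0n !addn0.
have w0 : [set w] != set0 by apply/set0Pn; exists w; rewrite inE.
rewrite (IH (subsetP (attach_sub A) _ wW)) big_cons (attach_cnt0 simpE A) /=.
rewrite (attach_cnt simpE A) ?sub1set // setUid.
have := pathprod_gt0 ls; move: (pathprod ls) => [//|p] _; nia.
Qed.

End Attaches.

Lemma graph_ofE N ps (i j : 'I_N) :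
  ([set i; j] \in graph_of N ps) = ((val i, val j) \in ps) || ((val j, val i) \in ps).
Proof.
rewrite inE; apply/existsP/orP => [[i' /existsP[j' /andP[/eqP eE ij]]]|].
  have [] : (i = i' /\ j = j') \/ (i = j' /\ j = i').
    have := set21 i j; rewrite eE => /set2P[] iE; move/eqP: eE; rewrite iE.
      by rewrite set2_eqr => /eqP->; left.
    by rewrite (setUC [set i']) set2_eqr => /eqP->; right.
  - by case=> -> ->; left.
  - by case=> -> ->; right.
case=> H; [exists i | exists j]; apply/existsP; [exists j | exists i]; rewrite H andbT //.
by rewrite setUC.
Qed.

(** Indices from [N] on fall back to [x0], so [val_vx] requires a bound. *)
Definition vtx N (x0 : 'I_N) i : 'I_N := insubd x0 i.

(** The stages of the construction: the vertices after the cycle are numbered in the order of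
    attachment, each joined to one smaller vertex. *)
Definition below N k : {set 'I_N} := [set i : 'I_N | val i < k].

(** * Graphs listed as a cycle followed by successively attached vertices *)

Section GraphOf.

Variables (N L M : nat) (tl : seq (nat * nat)) (x0 : 'I_N).
Hypothesis L3 : 2 < L.
Hypothesis NE : N = L + M.
Hypothesis tl2 : map snd tl = iota L M.
Hypothesis tl_lt : forall p, p \in tl -> p.1 < p.2.

Local Notation E := (graph_of N (cycle_list L ++ tl)).
Local Notation vx := (vtx x0).
Local Notation V := (@below N).

Lemma val_vx i : i < N -> val (vx i) = i.
Proof. by move=> iN; rewrite val_insubd iN. Qed.

Lemma mem_cycle_list i j : ((i, j) \in cycle_list L) = (i < L) && (j == i.+1 %% L).
Proof.
apply/mapP/andP => [[k]|[iL /eqP->]].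
  by rewrite mem_iota => /= kL [-> ->].
by exists i; rewrite ?mem_iota.
Qed.

Lemma tl_range p : p \in tl -> L <= p.2 < L + M.
Proof. by move=> /(map_f snd); rewrite tl2 mem_iota. Qed.

Lemma tl_fun p q k : (p, k) \in tl -> (q, k) \in tl -> p = q.
Proof.
move=> /(nthP (0, 0))[i i_lt iE] /(nthP (0, 0))[j j_lt jE].
have U : uniq (map snd tl) by rewrite tl2 iota_uniq.
have /eqP : nth 0 (map snd tl) i = nth 0 (map snd tl) j.
  by rewrite !(nth_map (0, 0)) // iE jE.
rewrite nth_uniq ?size_map // => /eqP ij; move: iE.
by rewrite ij jE => -[].
Qed.

Lemma simple_graph_of : simple_graph E.
Proof.
clear NE.
move=> e; rewrite inE => /existsP[i /existsP[j /andP[/eqP-> ij]]].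
rewrite cards2; suff -> : i != j by [].
apply: contraTneq ij => ->; rewrite mem_cat mem_cycle_list negb_or.
apply/andP; split; last by apply/negP => /tl_lt; rewrite /= ltnn.
apply/negP => /andP[]; move: (val j) => {}j jL /eqP jE.
case: (ltngtP j.+1 L) => jL'; [|lia|].
  by rewrite modn_small // in jE; lia.
by rewrite jL' modnn in jE; lia.
Qed.

Lemma graph_of_cyc : cyc_enum E L (fun i => vx (i %% L)).
Proof.
have lN i : i %% L < N.
  by apply: (@leq_trans L); rewrite ?ltn_mod ?NE ?leq_addr //; lia.
split=> // i j.
  by rewrite -val_eqE /= !val_vx.
have half a b : ((a %% L, b %% L) \in cycle_list L ++ tl) = (b == a.+1 %[mod L]).
  rewrite mem_cat mem_cycle_list ltn_mod (ltn_trans _ L3) //=.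
  rewrite -[(a %% L).+1]addn1 modnDml addn1; case: eqP => //= _.
  apply/negP => /tl_range /= /andP[+ _]; rewrite leqNgt ltn_mod.
  by rewrite (ltn_trans _ L3).
by rewrite graph_ofE /= !val_vx // !half.
Qed.

Lemma graph_of_cyc_set : cyc_set L (fun i => vx (i %% L)) = V L.
Proof.
apply/setP => x; rewrite inE; apply/imsetP/idP => [[i _ ->]|xL].
  by have iL := ltn_ord i; rewrite modn_small // val_vx // NE ltn_addr.
exists (Ordinal xL) => //; apply: val_inj; rewrite /= modn_small //.
by rewrite val_vx.
Qed.

Lemma belowS k : k < N -> V k.+1 = vx k |: V k.
Proof.
move=> kN; apply/setP => x; rewrite !inE -val_eqE /= val_vx // ltnS leq_eqVlt.
by [].
Qed.

Lemma graph_of_pend p k : (p, k) \in tl -> pend E (V k) (vx k) (vx p).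
Proof.
move=> pk; have /= /andP[Lk kN] := tl_range pk; have /= plt := tl_lt pk.
rewrite -NE in kN; have pN := ltn_trans plt kN.
split; rewrite ?inE ?val_vx ?ltnn // => q; rewrite inE => qk.
rewrite graph_ofE /= val_vx // !mem_cat !mem_cycle_list ltnNge Lk /=.
rewrite -val_eqE /= val_vx //; apply/idP/eqP => [|->]; last by rewrite pk !orbT.
case/or3P=> [/tl_lt /=|/andP[_ /eqP kE]|qk']; first by rewrite ltnNge ltnW.
  by move: Lk; rewrite kE leqNgt ltn_mod (ltn_trans _ L3).
exact: tl_fun qk' pk.
Qed.

Lemma graph_of_attach w k l : {subset path_list w k l <= tl} -> 0 < l <= 2 ->
  attach E (V k) (vx w) l (V (k + l)).
Proof.
case: l => [|[|[|l]]] // H _.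
  have wk : (w, k) \in tl by apply: H; rewrite /path_list /= addn0 inE.
  have /= /andP[_ kN] := tl_range wk; rewrite addn1 belowS ?NE //.
  exact: Attach1 (graph_of_pend wk).
have wk : (w, k) \in tl by apply: H; rewrite /path_list /= addn0 inE eqxx.
have kk : (k, k.+1) \in tl.
  by apply: H; rewrite /path_list /= addn1 subn1 /= !inE eqxx orbT.
have /= /andP[_ kN] := tl_range wk; have /= /andP[_ kN2] := tl_range kk.
rewrite addn2 belowS ?NE // belowS ?NE //.
apply: Attach2 (graph_of_pend wk) _.
by rewrite -belowS ?NE //; exact: graph_of_pend kk.
Qed.

Lemma graph_of_attaches w k ls : {subset pend_list w k ls <= tl} ->
  all (fun l => 0 < l <= 2) ls ->
  attaches E (vx w) (V k) ls (V (k + sumn ls)).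
Proof.
elim: ls k => [|l ls IH] k H /=; first by rewrite addn0; constructor.
case/andP=> l12 ls12; rewrite addnA.
apply: AttachesCons (graph_of_attach _ l12) (IH _ _ ls12) => p pH; apply: H.
  by rewrite /= mem_cat pH.
by rewrite /= mem_cat pH orbT.
Qed.

Lemma below_full : V N = setT.
Proof. by apply/setP => x; rewrite !inE ltn_ord. Qed.

End GraphOf.

Lemma pend_list_snd w k ls : map snd (pend_list w k ls) = iota k (sumn ls).
Proof.
elim: ls k => //= l ls IH k; rewrite map_cat IH iotaD; congr (_ ++ _).
by rewrite -map_comp -[k in RHS]addn0 iotaDl; apply: eq_map.
Qed.

Lemma pend_list_lt w k ls p : w < k -> p \in pend_list w k ls -> p.1 < p.2.
Proof.
elim: ls k => //= l ls IH k wk; rewrite mem_cat => /orP[/mapP[i _ ->]|].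
  by rewrite /=; case: eqP => /= i0; lia.
by apply: IH; rewrite ltn_addr.
Qed.

(** In [C_3], 9 nonempty subtrees exist, 6 of them through a given vertex and 4 through two; in
    [C_4] the numbers are 16, 10 and, for opposite vertices, 6. The final [r.*2] is [r(r+1)/2] for
    the last path plus 1 for the empty subtree. *)
Lemma nsub_Ugraph b s r (x := pathprod s) : 0 < b <= 2 -> 0 < r <= 2 ->
  all (fun l => 0 < l <= 2) s ->
  nsub (Ugraph 2 b s [:: r]) =
    (if b == 1 then 9 + x.-1 * 6 + r * (6 + x.-1 * 4)
     else 16 + x.-1 * 10 + r * (10 + x.-1 * 6)) +
    \sum_(l <- s) l.*2.-1 + r.*2.
Proof.
move=> b12 r12 s12; set L := 2 + b; pose M := sumn s + sumn [:: r].
pose N := 2 + b + sumn s + sumn [:: r].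
pose tl := pend_list 0 L s ++ pend_list 2 (L + sumn s) [:: r].
have L3 : 2 < L by rewrite /L; lia.
have NE : N = L + M by rewrite /N /M addnA.
have tl2 : map snd tl = iota L M by rewrite map_cat !pend_list_snd -iotaD.
have tl_lt p : p \in tl -> p.1 < p.2.
  by rewrite mem_cat => /orP[]; apply: pend_list_lt; lia.
have N0 : 0 < N by rewrite NE; lia.
pose x0 := Ordinal N0.
set E := Ugraph _ _ _ _.
have simpE : simple_graph E by exact: simple_graph_of L3 tl_lt.
have cE : cyc_enum E L (fun i => vtx x0 (i %% L)) by exact: graph_of_cyc NE tl2.
have CE : cyc_set L (fun i => vtx x0 (i %% L)) = below N L by exact: graph_of_cyc_set NE.
have A1 : attaches E (vtx x0 0) (below N L) s (below N (L + sumn s)).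
  apply: (graph_of_attaches x0 L3 NE tl2 tl_lt) => // p ps.
  by rewrite mem_cat ps.
have A2 : attaches E (vtx x0 2) (below N (L + sumn s)) [:: r]
                   (below N (L + sumn s + sumn [:: r])).
  apply: (graph_of_attaches x0 L3 NE tl2 tl_lt) => [p ps|]; last by rewrite /= r12.
  by rewrite mem_cat ps orbT.
have cntL ts : cnt E (below N L) [set x in map (fun i => vtx x0 (i %% L)) ts] =
               arcs_through L ts.
  by rewrite -CE; apply: (cnt_cyc simpE cE) => y; rewrite inE.
have b0 : vtx x0 0 \in below N L by rewrite inE val_vx //; lia.
have b2 : vtx x0 2 \in below N L by rewrite inE val_vx //; lia.
have n2 : [set vtx x0 2] != set0 by apply/set0Pn; exists (vtx x0 2); rewrite inE.
rewrite nsub_cnt -below_full -[below N N]/(below N (L + sumn s + sumn [:: r])).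
rewrite (attaches_cnt0 simpE A2) ?(subsetP (attaches_sub A1)) //.
rewrite (attaches_cnt0 simpE A1) // (attaches_cnt simpE A1) ?sub1set //.
have -> : cnt E (below N L) set0 = L * L by rewrite -CE; apply: cnt_cyc0 cE.
have -> : cnt E (below N L) [set vtx x0 0] = arcs_through L [:: 0].
  by rewrite -cntL; congr cnt; apply/setP => y; rewrite !inE mod0n.
have -> : cnt E (below N L) [set vtx x0 2] = arcs_through L [:: 2].
  by rewrite -cntL; congr cnt; apply/setP => y; rewrite !inE modn_small.
have -> : cnt E (below N L) [set vtx x0 0; vtx x0 2] = arcs_through L [:: 0; 2].
  by rewrite -cntL; congr cnt; apply/setP => y; rewrite !inE mod0n modn_small.
rewrite big_cons big_nil -/x /= muln1 addn0 /L.
by case: b b12 {simpE cE CE A1 A2 cntL b0 b2 n2 E L M N tl L3 NE tl2 tl_lt N0 x0} => [|[|[|b]]] // _;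
  [rewrite (_ : arcs_through 3 [:: 0] = 6) // (_ : arcs_through 3 [:: 2] = 6) //
     (_ : arcs_through 3 [:: 0; 2] = 4) //
  |rewrite (_ : arcs_through 4 [:: 0] = 10) // (_ : arcs_through 4 [:: 2] = 10) //
     (_ : arcs_through 4 [:: 0; 2] = 6) //];
  rewrite /=; lia.
Qed.

(** In the triangle with pendent vertices at 0 and 1, the trees through vertex 2 number
    [6 + 4 + 4 + 3 = 17], and each further pendent vertex at 2 doubles them. *)
Lemma nsub_U1 n : nsub (U1 (n + 5)) = 17 * 2 ^ n + n + 11.
Proof.
have pn : pathprod (nseq n 1) = 2 ^ n by elim: n => //= n ->; rewrite expnS.
have pendE k : [seq (2, i) | i <- iota k n] = pend_list 2 k (nseq n 1).
  by elim: n k {pn} => //= n IH k; rewrite IH addn0 addn1.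
pose L := 3; pose M := n + 2; pose N := n + 5.
pose tl := pend_list 0 3 [:: 1] ++ (pend_list 1 4 [:: 1] ++ pend_list 2 5 (nseq n 1)).
have L3 : 2 < L by [].
have NE : N = L + M by rewrite /N /L /M; lia.
have sn : sumn (nseq n 1) = n by rewrite sumn_nseq mul1n.
have tl2 : map snd tl = iota L M.
  by rewrite !map_cat !pend_list_snd sn /M addn2.
have tl_lt p : p \in tl -> p.1 < p.2.
  rewrite /tl mem_cat => /orP[|]; first exact: pend_list_lt.
  by rewrite mem_cat => /orP[]; exact: pend_list_lt.
have N0 : 0 < N by rewrite /N addnS.
pose x0 := Ordinal N0.
have UE : U1 N = graph_of N (cycle_list L ++ tl).
  rewrite /U1 /tl; congr graph_of; rewrite /= /cycle_list /= /N addnK.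
  by rewrite pendE.
rewrite -/N; set E := U1 N.
have simpE : simple_graph E by rewrite /E UE; exact: simple_graph_of L3 tl_lt.
have cE : cyc_enum E L (fun i => vtx x0 (i %% L)) by rewrite /E UE; exact: graph_of_cyc NE tl2.
have CE : cyc_set L (fun i => vtx x0 (i %% L)) = below N L by exact: graph_of_cyc_set NE.
have A0 : attaches E (vtx x0 0) (below N 3) [:: 1] (below N 4).
  rewrite /E UE; apply: (graph_of_attaches x0 L3 NE tl2 tl_lt) => // p ps.
  by rewrite mem_cat ps.
have A1 : attaches E (vtx x0 1) (below N 4) [:: 1] (below N 5).
  rewrite /E UE; apply: (graph_of_attaches x0 L3 NE tl2 tl_lt) => // p ps.
  by rewrite !mem_cat ps orbT.
have A2 : attaches E (vtx x0 2) (below N 5) (nseq n 1) (below N N).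
  have -> : below N N = below N (5 + sumn (nseq n 1)) by rewrite sn addnC.
  rewrite /E UE; apply: (graph_of_attaches x0 L3 NE tl2 tl_lt) => [p ps|].
    by rewrite !mem_cat ps !orbT.
  by apply/allP => l /nseqP[->].
have cntL ts : cnt E (below N L) [set x in map (fun i => vtx x0 (i %% L)) ts] =
               arcs_through L ts.
  by rewrite -CE; apply: (cnt_cyc simpE cE) => y; rewrite inE.
have lowP i k : i < k -> k <= 5 -> vtx x0 i \in below N k.
  by move=> ik k5; rewrite inE val_vx // (leq_trans ik) // (leq_trans k5) // leq_addl.
have n0 i (Z : {set 'I_N}) : vtx x0 i |: Z != set0.
  by apply/set0Pn; exists (vtx x0 i); rewrite setU11.
have n1 i : [set vtx x0 i] != set0 by rewrite -[[set _]]setU0.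
have E0 : cnt E (below N L) set0 = 9 by rewrite -CE; apply: cnt_cyc0 cE.
have c1 i : i < 3 -> cnt E (below N L) [set vtx x0 i] = 6.
  move=> i3; transitivity (arcs_through L [:: i]).
    by rewrite -cntL; congr cnt; apply/setP => y; rewrite !inE modn_small.
  by case: i i3 => [|[|[|i]]].
have c2 i j : i < 3 -> j < 3 -> i != j -> cnt E (below N L) [set vtx x0 i; vtx x0 j] = 4.
  move=> i3 j3 ij; transitivity (arcs_through L [:: i; j]).
    by rewrite -cntL; congr cnt; apply/setP => y; rewrite !inE !modn_small.
  by case: i i3 ij => [|[|[|i]]] // _; case: j j3 => [|[|[|j]]].
have c3 : cnt E (below N L) (vtx x0 0 |: [set vtx x0 1; vtx x0 2]) = 3.
  transitivity (arcs_through L [:: 0; 1; 2]) => //.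
  by rewrite -cntL; congr cnt; apply/setP => y; rewrite !inE !modn_small.
rewrite nsub_cnt -below_full (attaches_cnt0 simpE A2) ?lowP // pn.
rewrite (attaches_cnt0 simpE A1) ?lowP //.
rewrite (attaches_cnt simpE A1) ?sub1set ?lowP ?n1 //.
rewrite (attaches_cnt0 simpE A0) ?lowP //.
rewrite !(attaches_cnt simpE A0) ?subUset ?sub1set ?lowP ?n0 ?n1 //.
rewrite E0 !c1 // !c2 // c3 big_nseq iter_addn_0 !big_cons !big_nil /=.
by have := expn_gt0 2 n; rewrite /=; lia.
Qed.

(** * Cores *)


Section Core.

Variable (T : finType) (E C0 : {set {set T}}) (L : nat) (v : nat -> T).
Hypothesis simpE : simple_graph E.
Hypothesis uE : unicyclic E.
Hypothesis cC0 : is_cycle_of E C0.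
Hypothesis cv : cyc_enum E L v.
Let C := cyc_set L v.
Let D := D2set E.
Hypothesis C0C : forall e, e \in C0 -> e \subset C.
Hypothesis Dind : forall x y, x \in D -> y \in D -> [set x; y] \notin E.
Implicit Types (W Z : {set T}).

Lemma cyc_edge i : [set v i; v i.+1] \in E.
Proof. by rewrite (cyc_adj cv) eqxx. Qed.

Lemma cyc_pred i : exists j, v i = v j.+1.
Proof.
have L2 := cyc_gt2 cv; exists (i + L.-1).
have -> : (i + L.-1).+1 = i + 1 * L by lia.
by rewrite (cyc_addL cv).
Qed.

Lemma cyc_next2 i : v i != v i.+2.
Proof.
have L2 := cyc_gt2 cv.
by rewrite -{1}(addn0 i) -addn2 (cyc_eqD cv) (cyc_eq_small cv) //; lia.
Qed.

Lemma cyc_full : full E D C.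
Proof.
move=> x y /(cyc_setP cv)[i ->] iD iyE; have [j ij] := cyc_pred i.
have jE : [set v i; v j] \in E by rewrite ij setUC cyc_edge.
have [t [_ _ _ only]] := deg2_nbr simpE (mem_D2set E) iD jE.
have [E1|E1] := only _ (cyc_edge i).
  have e2 : v i.+1 = v j.+2 by apply/eqP; rewrite (cyc_eqS cv) ij.
  by have := cyc_next2 j; rewrite -e2 E1 eqxx.
by case: (only _ iyE) => ->; rewrite -?E1 (mem_cyc cv).
Qed.

Lemma cyc_spanned : spanned E C C.
Proof.
split=> // x y /(cyc_setP cv)[i ->] /(cyc_setP cv)[j ->].
have conn k : connect (adjE (induced E C)) (v i) (v (i + k)).
  elim: k => [|k IH]; first by rewrite addn0.
  apply: connect_trans IH (connect1 _); rewrite addnS /adjE inE cyc_edge.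
  by rewrite subUset !sub1set !(mem_cyc cv).
have := conn (j + i * L.-1); have -> : i + (j + i * L.-1) = j + i * L.
  by have := cyc_gt2 cv; nia.
by rewrite (cyc_addL cv).
Qed.

Lemma card_induced_cyc : #|induced E C| = L.
Proof.
have -> : induced E C = [set [set v (val i); v i.+1] | i : 'I_L].
  apply/setP => e; apply/idP/imsetP => [|[i _ ->]]; last first.
    by rewrite inE cyc_edge subUset !sub1set !(mem_cyc cv).
  rewrite inE => /andP[eE eC]; have /eqP/cards2P[x [y [_ eE']]] := simpE eE.
  move: eE eC; rewrite eE' subUset !sub1set => xyE /andP[/(cyc_setP cv)[i xi] /(cyc_setP cv)[j yj]].
  have L0 : 0 < L by apply: ltn_trans (cyc_gt2 cv).
  have norm k : exists2 k' : 'I_L, True & [set v k; v k.+1] = [set v (val k'); v k'.+1].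
    exists (Ordinal (ltn_pmod k L0)) => //=; rewrite -(cyc_modE cv).
    congr [set _; _]; apply/eqP; by rewrite (cyc_eqS cv) -(cyc_modE cv).
  move: xyE; rewrite xi yj (cyc_adj cv) => /orP[]/eqP->.
    by have [k _ ->] := norm i; exists k.
  by rewrite setUC; have [k _ ->] := norm j; exists k.
rewrite card_imset ?card_ord // => i j eE; apply: val_inj; apply/eqP.
rewrite -(cyc_eq_small cv) ?ltn_ord //.
have : v (val i) \in [set v (val j); v j.+1] by rewrite -eE set21.
case/set2P=> [->|ij] //.
have : v i.+1 \in [set v (val j); v j.+1] by rewrite -eE set22.
case/set2P=> E1; last by move/eqP: E1; rewrite (cyc_eqS cv).
have := cyc_next2 (val j); rewrite -E1.
by rewrite (cyc_eqS cv) ij eqxx.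
Qed.

(** The successor on the cycle of a vertex of degree 2 is not of degree 2. *)
Lemma card_cyc_D2 : (#|D :&: C|).*2 <= L.
Proof.
have [/= f fE] : exists f : 'I_L -> 'I_L, forall i, v (f i) = v i.+1.
  have L0 : 0 < L by apply: ltn_trans (cyc_gt2 cv).
  by exists (fun i => Ordinal (ltn_pmod i.+1 L0)) => i; rewrite /= -(cyc_modE cv).
pose A := [set i : 'I_L | v i \in D].
have cA : #|D :&: C| = #|A|.
  have vi : injective (fun i : 'I_L => v i).
    by move=> i j /eqP; rewrite (cyc_eq_small cv) ?ltn_ord // => /eqP/val_inj.
  rewrite -(card_imset _ vi); apply: eq_card => x; apply/setIP/imsetP.
    by case=> xD /imsetP[i _ xi]; exists i; rewrite // inE -xi.
  by case=> i; rewrite inE => iD ->; rewrite iD (mem_cyc cv).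
have fi : injective f.
  move=> i j /(congr1 (fun k : 'I_L => v k)); rewrite !fE => /eqP.
  by rewrite (cyc_eqS cv) (cyc_eq_small cv) ?ltn_ord // => /eqP/val_inj.
have dis : [disjoint A & f @: A].
  rewrite -setI_eq0; apply/eqP/setP => x; rewrite in_set0; apply/negP => /setIP[].
  move=> + /imsetP[i iA xi]; rewrite xi inE fE => iD'; rewrite inE in iA.
  by move/negP: (Dind iA iD'); rewrite cyc_edge.
have := max_card (mem (A :|: f @: A)).
rewrite card_ord cardsU disjoint_setI0 // cards0 card_imset // cA; lia.
Qed.

Lemma free_nbr i : v i \notin D -> exists2 u, u \notin C & [set u; v i] \in E.
Proof.
move=> iD; have [j ij] := cyc_pred i.
case: (boolP [exists u, (u \notin C) && ([set u; v i] \in E)]).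
  by case/existsP=> u /andP[]; exists u.
rewrite negb_exists => /forallP H; case/negP: iD; rewrite inE.
have neq : [set v i; v j] != [set v i; v i.+1].
  rewrite set2_eqr; apply: contraNneq (cyc_next2 j) => ->; rewrite eq_sym.
  by rewrite (cyc_eqS cv) ij.
have -> : deg E (v i) = #|[set [set v i; v j]; [set v i; v i.+1]]|; last by rewrite cards2 neq.
apply: eq_card => e; rewrite !inE; apply/andP/orP => [[eE ie]|[]/eqP->].
- have [y yi eE'] := edge_ends simpE eE ie; rewrite eE' in eE *.
  have := H y; rewrite setUC eE andbT negbK => /(cyc_setP cv)[k yk].
  move: eE; rewrite yk (cyc_adj cv) => /orP[]/eqP E1; [right | left].
    by rewrite E1.
  by rewrite set2_eqr -(cyc_eqS cv) -E1 ij.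
- by rewrite set21 setUC {1}ij cyc_edge.
- by rewrite set21 cyc_edge.
Qed.

Definition pts (ts : seq nat) : {set T} := [set x in map v ts].

Lemma pts_cons t ts : pts (t :: ts) = v t |: pts ts.
Proof. by apply/setP => x; rewrite !inE. Qed.

Lemma pts1 t : pts [:: t] = [set v t].
Proof. by apply/setP => x; rewrite !inE. Qed.

Lemma pts_sub ts : pts ts \subset C.
Proof. by apply/subsetP => x; rewrite inE => /mapP[t _ ->]; rewrite (mem_cyc cv). Qed.

Lemma cnt_pts ts : cnt E C (pts ts) = arcs_through L ts.
Proof. by apply: (cnt_cyc simpE cv) => x; rewrite inE. Qed.

Lemma attach_pts W t l W' p ts : C \subset W -> attach E W (v t) l W' ->
  cnt E W' (pts (p :: ts)) = cnt E W (pts (p :: ts)) + l * cnt E W (pts [:: t, p & ts]).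
Proof.
move=> CW A; rewrite (attach_cnt simpE A) ?(subset_trans (pts_sub _)) //.
  by rewrite -pts_cons.
by rewrite pts_cons; apply/set0Pn; exists (v p); rewrite setU11.
Qed.

Lemma attach_pts0 W t l W' : attach E W (v t) l W' ->
  cnt E W' set0 = cnt E W set0 + l * cnt E W (pts [:: t]) + l.*2.-1.
Proof. by move=> A; rewrite (attach_cnt0 simpE A) pts1. Qed.

(** Allows the bound [F] to be checked at cycle vertices only. It holds for all [Z] in the cycle
    because attaching at [v i] involves the counts for [v i |: Z] as well. *)
Definition dominated W := forall z, z \in W ->
  exists2 c, c \in C & forall Z, Z \subset C -> cnt E W (z |: Z) <= cnt E W (c |: Z).

Lemma cnt_cyc_gt1 W i : C \subset W -> 1 < cnt E W [set v i].
Proof.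
move=> CW; have L2 := cyc_gt2 cv; have := cnt_cyc1 i simpE cv.
suff : cnt E C [set v i] <= cnt E W [set v i] by rewrite /C; nia.
apply/subset_leq_card/subsetP => p; rewrite !inE => /and3P[-> pC ->].
by rewrite (subset_trans pC CW).
Qed.

Lemma dominated_attach W i l W' : C \subset W -> dominated W ->
  attach E W (v i) l W' -> dominated W'.
Proof.
move=> CW domW A z zW'; have ZW Z : Z \subset C -> Z \subset W.
  by move/subset_trans; apply.
have iW : v i \in W by apply: (subsetP CW); rewrite (mem_cyc cv).
case: (boolP (z \in W)) => zW; last first.
  exists (v i); rewrite ?(mem_cyc cv) // => Z ZC; case: (eqVneq Z set0) => [->|Z0].
    rewrite !setU0; apply: leq_trans (attach_new0 simpE A zW' zW (cnt_cyc_gt1 i CW) (leqnn _)) _.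
    rewrite (attach_cnt simpE A) ?sub1set ?setUid ?mulSn //.
    by apply/set0Pn; exists (v i); rewrite inE.
  by apply: (attach_new simpE A) => //; apply: ZW.
have [c cC cdom] := domW _ zW; exists c => // Z ZC.
have U0 x Y : x |: Y != set0 :> {set T} by apply/set0Pn; exists x; rewrite setU11.
have cW := subsetP CW _ cC.
rewrite !(attach_cnt simpE A) ?subUset ?sub1set ?zW ?cW ?ZW ?U0 //.
rewrite !(setUCA [set v i]) leq_add ?cdom // leq_mul2l cdom ?orbT //.
by rewrite subUset sub1set (mem_cyc cv).
Qed.

(** No pendent segment has been attached at [v j] so far, so one that starts there is still new. *)
Definition untouched W j := forall u, u \in W -> u \notin C -> [set u; v j] \notin E.

Definition core W := [/\ spanned E C W, full E D W & dominated W].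

Lemma core_cyc : core C.
Proof. by split; [exact: cyc_spanned | exact: cyc_full | move=> z zC; exists z]. Qed.

Lemma core_sub W : core W -> C \subset W.
Proof. by case=> -[]. Qed.

Lemma untouched_cyc j : untouched C j.
Proof. by move=> u ->. Qed.

Lemma core_attach W i : core W -> v i \notin D -> untouched W i ->
  exists l W', [/\ attach E W (v i) l W', core W', 0 < l <= 2,
    (forall j, v j != v i -> untouched W j -> untouched W' j) &
    #|D :&: W'| = #|D :&: W| + l.-1 /\ #|induced E W'| = #|induced E W| + l].
Proof.
move=> cW iD unt; have CW := core_sub cW; have [sW fW dW] := cW.
have [u uC uiE] := free_nbr iD.
have uW : u \notin W by apply/negP => /unt/(_ uC); rewrite uiE.
have iW : v i \in W by apply: (subsetP CW); rewrite (mem_cyc cv).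
have [l [W' [A sW' fW' _ [l12 _ cD cI]]]] :=
  attach_exists simpE uE cC0 C0C (mem_D2set E) Dind sW fW iW uW uiE.
exists l, W'; split=> //; first by split=> //; exact: dominated_attach A.
move=> j ji untj x xW' xC; case: (boolP (x \in W)) => xW; first exact: untj.
have jW : v j \in W by apply: (subsetP CW); rewrite (mem_cyc cv).
case: A xW' {sW' fW' cD cI} => [u' [_ _ nb]|u' t [uW' _ nb] [_ _ nb2]].
  by case/setU1P=> [->|xW2]; [rewrite nb | rewrite xW2 in xW].
case/setU1P=> [->|/setU1P[->|xW2]]; last by rewrite xW2 in xW.
  rewrite nb2 ?inE ?jW ?orbT //; by apply: contraNneq uW' => <-.
by rewrite nb.
Qed.

(** Growth counts edges and vertices of degree 2; [card_edges] turns these into the numbers of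
    segments of each length. *)
Lemma core_bound W F K c1 c2 : core W -> 1 < F ->
  (forall i, i < L -> cnt E W (pts [:: i]) <= F) -> cnt E W set0 <= F + K ->
  #|D :&: W| = c2 -> #|induced E W| = c1 + c2.*2 ->
  exists a b, [/\ #|free_edges E| = c1 + a, #|D| = c2 + b &
                 nsub E <= (F * 2 ^ a * 3 ^ b + K + a + 3 * b).+1].
Proof.
move=> cW F1 HF HK HD HI; have CW := core_sub cW; have [sW fW dW] := cW.
have HF' z : z \in W -> cnt E W [set z] <= F.
  move=> /dW[c /(cyc_setP cv)[i ->] /(_ _ (sub0set _))]; rewrite !setU0.
  move/leq_trans; apply; rewrite (cyc_modE cv) -pts1; apply: HF.
  by rewrite ltn_mod (ltn_trans _ (cyc_gt2 cv)).
have w0W : v 0 \in W by apply: (subsetP CW); rewrite (mem_cyc cv).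
have [a [b [_ cD cE cN]]] :=
  grow_bound simpE uE cC0 C0C (mem_D2set E) Dind sW fW w0W F1 HF' HK.
exists a, b; rewrite nsub_cnt ltnS cN cD HD; split=> //.
by have := card_edges simpE Dind; rewrite cE HI -/D cD HD; lia.
Qed.

Lemma bare_bound :
  exists a b F K, [/\ F.*2 = L * L.+1, F + K = L * L,
    #|free_edges E| = L - (#|D :&: C|).*2 + a, #|D| = #|D :&: C| + b &
    nsub E <= (F * 2 ^ a * 3 ^ b + K + a + 3 * b).+1].
Proof.
have L2 := cyc_gt2 cv; have F2 := cnt_cyc1 0 simpE cv.
set F := cnt _ _ _ in F2.
have [||||a [b [H1 H2 H3]]] := @core_bound C F (L * L - F) (L - (#|D :&: C|).*2) _ core_cyc _ _ _ (erefl _) _.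
- by nia.
- by move=> i _; rewrite -leq_double F2 pts1 (cnt_cyc1 i simpE cv).
- by rewrite (cnt_cyc0 simpE cv); nia.
- by rewrite card_induced_cyc subnK // card_cyc_D2.
- by exists a, b, F, (L * L - F); split=> //; nia.
Qed.

Lemma two_attached p q : v p \notin D -> v q \notin D -> v q != v p ->
  exists s r W, [/\ 0 < s <= 2, 0 < r <= 2, core W,
    (forall j, v j != v p -> v j != v q -> untouched W j) &
    [/\ #|D :&: W| = #|D :&: C| + s.-1 + r.-1, #|induced E W| = L + s + r,
      cnt E W set0 = L * L + s * arcs_through L [:: p] + s.*2.-1 +
        r * (arcs_through L [:: q] + s * arcs_through L [:: p; q]) + r.*2.-1 &
      forall i ts, cnt E W (pts (i :: ts)) =
        arcs_through L (i :: ts) + s * arcs_through L [:: p, i & ts] +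
        r * (arcs_through L [:: q, i & ts] + s * arcs_through L [:: p, q, i & ts])]].
Proof.
move=> pD qD qp.
have [s [W1 [A1 cW1 s12 un1 [cD1 cI1]]]] := core_attach core_cyc pD (@untouched_cyc p).
have [r [W2 [A2 cW2 r12 un2 [cD2 cI2]]]] :=
  core_attach cW1 qD (un1 _ qp (@untouched_cyc q)).
have CC : C \subset C by [].
have CW1 := core_sub cW1.
exists s, r, W2; split=> //.
  by move=> j jp jq; apply: un2 => //; apply: un1 => //; exact: untouched_cyc.
split; first by rewrite cD2 cD1.
- by rewrite cI2 cI1 card_induced_cyc.
- rewrite (attach_pts0 A2) (attach_pts0 A1) (attach_pts _ _ CC A1).
  by rewrite (cnt_cyc0 simpE cv) !cnt_pts.
- move=> i ts; rewrite (attach_pts _ _ CW1 A2) !(attach_pts _ _ CC A1) !cnt_pts.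
  by [].
Qed.

End Core.

(** * Comparison with the extremal graphs *)


(* [core_type c1 c2 F K]: the core has c1 segments of length 1 and c2 of length 2, at
   most F subtrees through any vertex and at most F + K nonempty subtrees. In
   [CoreL_rs] the cycle has length L and two branch vertices, at which pendent
   segments of lengths r and s are kept. *)
Inductive core_type : nat -> nat -> nat -> nat -> Prop :=
| CoreBare n1 n2 F K of 3 <= n1 + n2 & F.*2 = (n1 + n2.*2) * (n1 + n2.*2).+1
    & F + K = (n1 + n2.*2) * (n1 + n2.*2) : core_type n1 n2 F K
| Core3_11 : core_type 3 1 20 7
| Core3_12 : core_type 2 2 30 9
| Core3_22 : core_type 1 3 42 13
| Core4_11 : core_type 2 2 32 12
| Core4_12 : core_type 1 3 48 14
| Core4_22 : core_type 0 4 66 20.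

Lemma unicyclic_enum (T : finType) (E : {set {set T}}) :
  simple_graph E -> unicyclic E ->
  exists C0 L v, [/\ is_cycle_of E C0, cyc_enum E L v &
                  forall e, e \in C0 -> e \subset cyc_set L v].
Proof.
move=> simpE uE; have [_ [C0 [cC0 _]]] := uE.
by have [L [v [cv C0C]]] := cycle_of_enum simpE uE cC0; exists C0, L, v.
Qed.

Lemma unicyclic_bound (T : finType) (E : {set {set T}}) :
  simple_graph E -> unicyclic E ->
  (forall x y, x \in D2set E -> y \in D2set E -> [set x; y] \notin E) ->
  exists c1 c2 F K a b,
    [/\ core_type c1 c2 F K, #|free_edges E| = c1 + a, #|D2set E| = c2 + b &
        nsub E <= (F * 2 ^ a * 3 ^ b + K + a + 3 * b).+1].
Proof.
move=> simpE uE Dind; have [C0 [L [v [cC0 cv C0C]]]] := unicyclic_enum simpE uE.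
set D := D2set E in Dind *.
have n2L := card_cyc_D2 cv Dind; rewrite -/D in n2L; have L3 := cyc_gt2 cv.
(* [L - #|D :&: C|] is the number of branch vertices on the cycle. If it is at most 2, then, as at
   most half of the cycle has degree 2, the cycle has length 3 or 4. *)
case: (leqP 3 (L - #|D :&: cyc_set L v|)) => k3.
  have [a [b [F [K [F2 FK o_a d_b bnd]]]]] := bare_bound simpE uE cC0 cv C0C Dind.
  exists (L - #|D :&: cyc_set L v|.*2), #|D :&: cyc_set L v|, F, K, a, b; split=> //.
  by apply: CoreBare; rewrite ?subnK //; lia.
have n2_gt0 : 0 < #|D :&: cyc_set L v| by lia.
have [x /setIP[xD /(cyc_setP cv)[t xt]]] := card_gt0P n2_gt0.
(* Rotated so that position 0 has degree 2, the branch vertices are at 1 and 2 for the triangle and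
   at 1 and 3 for the 4-cycle. *)
have [w [cw CE w0]] : exists w, [/\ cyc_enum E L w, cyc_set L w = cyc_set L v & w 0 \in D].
  exists (fun i => v (t + i)); rewrite addn0 -xt (cyc_set_shift cv t); split=> //.
  exact: cyc_shift.
have C0w e : e \in C0 -> e \subset cyc_set L w by rewrite CE; exact: C0C.
rewrite -CE in n2L k3 n2_gt0; clear x xD xt CE v cv t C0C.
have nextN i : w i \in D -> w i.+1 \notin D.
  by move=> iD; apply/negP => iD'; move/negP: (Dind _ _ iD iD'); rewrite (cyc_edge cw).
have w1 := nextN _ w0.
have wne i j : i < L -> j < L -> i != j -> w i != w j.
  by move=> iL jL; rewrite (cyc_eq_small cw).
have [EL|EL] : L = 3 \/ L = 4 by lia.
  subst L; have n2 : #|D :&: cyc_set 3 w| = 1 by lia.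
  have w2 : w 2 \notin D.
    apply/negP => /nextN; have -> : w 3 = w 0 by rewrite (cyc_modE cw).
    by rewrite w0.
  have [|s [r [W [s12 r12 cW _ [cD cI c0 cP]]]]] :=
    two_attached simpE uE cC0 cw C0w Dind w1 w2; first exact: wne.
  rewrite n2 in cD.
  pose F := if s + r == 2 then 20 else if s + r == 3 then 30 else 42.
  pose K := if s + r == 2 then 7 else if s + r == 3 then 9 else 13.
  have HF i : i < 3 -> cnt E W (pts w [:: i]) <= F.
    rewrite cP /F; move: s12 r12; clear; case: i => [|[|[|i]]] // + + _;
    by case: s => [|[|[|s]]] //; case: r => [|[|[|r]]].
  have HK : cnt E W set0 <= F + K.
    rewrite c0 /F /K; move: s12 r12; clear;
    by case: s => [|[|[|s]]] //; case: r => [|[|[|r]]].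
  have F1 : 1 < F by rewrite /F; case: ifP => // _; case: ifP.
  (* Segments of length 1 in the core: one cycle edge and [(2 - s) + (2 - r)] pendent ones. *)
  have [|a [b [H1 H2 H3]]] := core_bound simpE uE cC0 cw C0w Dind
     (c1 := 5 - s - r) cW F1 HF HK cD _.
    by rewrite cI; move: s12 r12; clear; lia.
  exists (5 - s - r), (1 + s.-1 + r.-1), F, K, a, b; split=> //.
  move: s12 r12; rewrite /F /K; clear.
  by case: s => [|[|[|s]]] //; case: r => [|[|[|r]]] // _ _; constructor.
subst L; have n2 : #|D :&: cyc_set 4 w| = 2 by lia.
have w3 : w 3 \notin D.
  apply/negP => /nextN; have -> : w 4 = w 0 by rewrite (cyc_modE cw).
  by rewrite w0.
have [|s [r [W [s12 r12 cW _ [cD cI c0 cP]]]]] :=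
  two_attached simpE uE cC0 cw C0w Dind w1 w3; first exact: wne.
rewrite n2 in cD.
pose F := if s + r == 2 then 32 else if s + r == 3 then 48 else 66.
pose K := if s + r == 2 then 12 else if s + r == 3 then 14 else 20.
have HF i : i < 4 -> cnt E W (pts w [:: i]) <= F.
  rewrite cP /F; move: s12 r12; clear; case: i => [|[|[|[|i]]]] // + + _;
  by case: s => [|[|[|s]]] //; case: r => [|[|[|r]]].
have HK : cnt E W set0 <= F + K.
  rewrite c0 /F /K; move: s12 r12; clear;
  by case: s => [|[|[|s]]] //; case: r => [|[|[|r]]].
have F1 : 1 < F by rewrite /F; case: ifP => // _; case: ifP.
have [|a [b [H1 H2 H3]]] := core_bound simpE uE cC0 cw C0w Dind
   (c1 := 4 - s - r) cW F1 HF HK cD _.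
  by rewrite cI; move: s12 r12; clear; lia.
exists (4 - s - r), (2 + s.-1 + r.-1), F, K, a, b; split=> //.
move: s12 r12; rewrite /F /K; clear.
by case: s => [|[|[|s]]] //; case: r => [|[|[|r]]] // _ _; constructor.
Qed.

Lemma unicyclic_bound_free (T : finType) (E : {set {set T}}) :
  simple_graph E -> unicyclic E -> D2set E = set0 ->
  exists c F K a,
    [/\ [\/ [/\ c = 6, F = 34 & K = 11], [/\ c = 6, F = 32 & K = 12] |
         [/\ 5 <= c, F.*2 = c * c.+1 & F + K = c * c]],
        #|free_edges E| = c + a & nsub E <= (F * 2 ^ a + K + a).+1].
Proof.
move=> simpE uE D0; have [C0 [L [v [cC0 cv C0C]]]] := unicyclic_enum simpE uE.
have Dind x y : x \in D2set E -> y \in D2set E -> [set x; y] \notin E by rewrite D0 inE.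
have DW W : #|D2set E :&: W| = 0 by rewrite D0 set0I cards0.
have nD x : x \notin D2set E by rewrite D0 inE.
have L3 := cyc_gt2 cv.
have wne i j : i < L -> j < L -> i != j -> v i != v j.
  by move=> iL jL; rewrite (cyc_eq_small cv).
(* From length 5 on the bare cycle suffices, its ratio being at most 15/32. The triangle keeps a
   pendent edge at all three vertices, the 4-cycle at two opposite ones. *)
case: (leqP 5 L) => L5.
  have [a [b [F [K [F2 FK o_a d_b bnd]]]]] := bare_bound simpE uE cC0 cv C0C Dind.
  move: o_a d_b bnd; rewrite DW D0 cards0 subn0 => o_a; case: b => // _.
  rewrite muln1 addn0 => bnd; exists L, F, K, a; split=> //.
  by constructor 3; split.
have Db W F K c : core E L v W -> 1 < F ->
    (forall i, i < L -> cnt E W (pts v [:: i]) <= F) -> cnt E W set0 <= F + K ->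
    #|induced E W| = c ->
    exists a, #|free_edges E| = c + a /\ nsub E <= (F * 2 ^ a + K + a).+1.
  move=> cW F1 HF HK HI.
  have [|a [b [H1 H2 H3]]] :=
    core_bound simpE uE cC0 cv C0C Dind (c1 := c) cW F1 HF HK (DW W) _.
    by rewrite addn0.
  move: H2 H3; rewrite D0 cards0; case: b => // _; rewrite muln1 addn0 => H3.
  by exists a.
have [EL|EL] : L = 3 \/ L = 4 by lia.
  subst L; have [|s [r [W [s12 r12 cW un [cD cI c0 cP]]]]] :=
    two_attached simpE uE cC0 cv C0C Dind (nD (v 0)) (nD (v 1)); first exact: wne.
  have [q [W' [A cW' q12 _ [cD' cI']]]] :=
    core_attach simpE uE cC0 cv C0C Dind cW (nD (v 2)) (un _ (wne 2 0 isT isT isT) (wne 2 1 isT isT isT)).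
  have s1 : s = 1 by move: cD; rewrite !DW; lia.
  have r1 : r = 1 by move: cD; rewrite !DW; lia.
  have q1 : q = 1 by move: cD'; rewrite !DW; lia.
  subst s r q; have CW := core_sub cW.
  have [||||a [H1 H2]] := Db W' 34 11 6 cW' => //.
  - move=> i i3; rewrite (attach_pts simpE cv _ _ CW A) !cP.
    by case: i i3 => [|[|[|i]]].
  - by rewrite (attach_pts0 simpE A) c0 cP.
  - by rewrite cI' cI.
  - by exists 6, 34, 11, a; split=> //; constructor 1.
subst L; have [|s [r [W [s12 r12 cW un [cD cI c0 cP]]]]] :=
  two_attached simpE uE cC0 cv C0C Dind (nD (v 0)) (nD (v 2)); first exact: wne.
have s1 : s = 1 by move: cD; rewrite !DW; lia.
have r1 : r = 1 by move: cD; rewrite !DW; lia.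
subst s r; have [||||a [H1 H2]] := Db W 32 12 6 cW => //.
- by move=> i i4; rewrite cP; case: i i4 => [|[|[|[|i]]]].
- by rewrite c0.
- by exists 6, 32, 12, a; split=> //; constructor 2.
Qed.

(** * Values of the extremal graphs and numerical inequalities *)

Lemma sumn_pathprod x y :
  pathprod (nseq x 2 ++ nseq y 1) = 3 ^ x * 2 ^ y /\
  \sum_(l <- nseq x 2 ++ nseq y 1) l.*2.-1 = 3 * x + y.
Proof.
split; last by rewrite big_cat !big_nseq !iter_addn_0 /=; lia.
elim: x => [|x IH] /=; last by rewrite IH expnS mulnA.
by rewrite mul1n; elim: y => //= y ->; rewrite expnS.
Qed.

Lemma Ugraph_value x y b r : 0 < b <= 2 -> 0 < r <= 2 ->
  nsub (Ugraph 2 b (nseq x 2 ++ nseq y 1) [:: r]) =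
  if b == 1 then 3 ^ x * 2 ^ y * (6 + 4 * r) + 3 + r.*2 + 2 * r + 3 * x + y
  else 3 ^ x * 2 ^ y * (10 + 6 * r) + 6 + r.*2 + 4 * r + 3 * x + y.
Proof.
move=> b12 r12; rewrite nsub_Ugraph //; last first.
  by rewrite all_cat !all_nseq /= !orbT.
have [-> ->] := sumn_pathprod x y.
have : 0 < 3 ^ x * 2 ^ y by rewrite muln_gt0 !expn_gt0.
by case: (_ * _) => [//|p] _; case: ifP => _; lia.
Qed.


(** Quadratic against exponential growth, started from the pairs with [n1 + n2 = 3]. The first
    inequality is [9 * F <= 8 * (2 ^ n1 * 3 ^ n2)] doubled. *)
Lemma bare_cycle_ineq n1 n2 (L := n1 + n2.*2) : 3 <= n1 + n2 ->
  9 * (L * L.+1) <= 16 * (2 ^ n1 * 3 ^ n2) /\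
  9 * (L * L) <= 8 * (2 ^ n1 * 3 ^ n2) + 9 * (4 + n1 + 3 * n2).
Proof.
rewrite {}/L; elim: n1 => [|n1 IH].
  elim: n2 => [//|n2 IH] n3; case: (ltnP n2 3) => n4.
    by case: n2 n3 n4 {IH} => [|[|[|n2]]].
  have [] := IH n4; rewrite expnS !mul1n doubleS !add0n.
  move: (3 ^ n2) => p; have : n2 * 3 <= n2 * n2 by rewrite leq_mul2l n4 orbT.
  lia.
move=> n3; case: (ltnP (n1 + n2) 3) => n4.
  by case: n1 n3 n4 {IH} => [|[|[|n1]]]; case: n2 => [|[|[|n2]]].
have [] := IH n4; rewrite expnS -mulnA; move: (2 ^ n1 * 3 ^ n2) => p.
have : 3 <= n1 + n2.*2 by lia.
rewrite (addSn n1 n2.*2); move: (n1 + n2.*2) => L L3.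
have : L * 3 <= L * L by rewrite leq_mul2l L3 orbT.
lia.
Qed.

Lemma bare_ineq_twos n (L := n.*2) : 3 <= n ->
  27 * (L * L.+1) <= 44 * 3 ^ n /\ 27 * (L * L) <= 22 * 3 ^ n + 27 * (8 + 3 * n).
Proof.
rewrite {}/L; elim: n => [//|n IH] n3; case: (ltnP n 3) => n4.
  by case: n n3 n4 {IH} => [|[|[|n]]].
have [] := IH n4; rewrite expnS doubleS; move: (3 ^ n) => p.
have : n * 3 <= n * n by rewrite leq_mul2l n4 orbT.
lia.
Qed.

Lemma bare_ineq_one_two n (L := n.+2) : 2 <= n ->
  2 * (L * L.+1) <= 10 * 2 ^ n /\ 4 * (L * L) <= 10 * 2 ^ n + 4 * (4 + n).
Proof.
rewrite {}/L; elim: n => [//|n IH] n3; case: (ltnP n 2) => n4.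
  by case: n n3 n4 {IH} => [|[|n]].
have [] := IH n4; rewrite expnS; move: (2 ^ n) => p.
have : n * 2 <= n * n by rewrite leq_mul2l n4 orbT.
lia.
Qed.

Lemma bare_ineq_ones n : 3 <= n ->
  6 * (n * n.+1) <= 10 * 2 ^ n /\
  4 * (n * n + n * n.+1 + 3) <= 10 * 2 ^ n + 4 * (4 + n).
Proof.
elim: n => [//|n IH] n3; case: (ltnP n 3) => n4.
  by case: n n3 n4 {IH} => [|[|[|n]]].
have [] := IH n4; rewrite expnS; move: (2 ^ n) => p.
have : n * 3 <= n * n by rewrite leq_mul2l n4 orbT.
lia.
Qed.

Lemma bare_ineq_free n : 5 <= n ->
  16 * (n * n.+1) <= 17 * 2 ^ n /\ 32 * (n * n) <= 17 * 2 ^ n + 32 * (5 + n).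
Proof.
elim: n => [//|n IH] n5; case: (ltnP n 5) => n4.
  by case: n n5 n4 {IH} => [|[|[|[|[|n]]]]].
have [] := IH n4; rewrite expnS; move: (2 ^ n) => p.
have : n * 5 <= n * n by rewrite leq_mul2l n4 orbT.
lia.
Qed.


(** Both sides are linear in [p]: the second hypothesis is the case [p = 1], the first compares the
    slopes. *)
Lemma scale_ineq k F R K c p : k * F <= R -> k * (F + K) <= R + c -> 0 < p ->
  k * (F * p + K) <= R * p + c.
Proof.
case: p => // p FR FKR _; have : k * F * p <= R * p by rewrite leq_mul2r FR orbT.
rewrite !mulnS; move: FKR; rewrite !mulnDr -mulnA; lia.
Qed.

(** Equality at [Core4_11]: 8/9 is [32 / (2^2 * 3^2)], and [4 = 12 - 2 - 3 * 2]. *)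
Lemma core_ineq c1 c2 F K : core_type c1 c2 F K ->
  9 * F <= 8 * (2 ^ c1 * 3 ^ c2) /\
  9 * (F + K) <= 8 * (2 ^ c1 * 3 ^ c2) + 9 * (4 + c1 + 3 * c2).
Proof.
case=> // n1 n2 {}F {}K n3 F2 ->; have [] := bare_cycle_ineq n3; rewrite -F2; lia.
Qed.

(** Equality at [Core4_22]: 22/27 is [66 / 3^4], and [8 = 20 - 3 * 4]. *)
Lemma core_ineq_twos c2 F K : core_type 0 c2 F K ->
  27 * F <= 22 * 3 ^ c2 /\ 27 * (F + K) <= 22 * 3 ^ c2 + 27 * (8 + 3 * c2).
Proof.
move E : 0 => c1 H; case: H E => // n1 n2 {}F {}K n3 F2 -> E.
move: n3 F2; rewrite -E add0n => n3 F2.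
by have [] := bare_ineq_twos n3; rewrite -F2; lia.
Qed.

(** The single segment of length 2 is in the core or is attached later, so its factor [3 ^ b] stays
    on the left. Equality holds at [Core3_11], where [20 / 2^3 = 10 / 4]. *)
Lemma core_ineq_one c1 c2 F K b : core_type c1 c2 F K -> c2 + b = 1 ->
  4 * (F * 3 ^ b) <= 10 * 2 ^ c1 /\
  4 * (F * 3 ^ b + (K + 3 * b)) <= 10 * 2 ^ c1 + 4 * (4 + c1).
Proof.
case=> [n1 n2 {}F {}K n3 F2 FK||||||] cb; try lia.
  2: by have -> : b = 0 by lia.
move: n3 F2 FK cb; case: n2 => [|[|n2]] // n3 F2 FK; case: b => [|[|b]] // _.
  rewrite !addn0 in n3 F2 FK; have [] := bare_ineq_ones n3; lia.
rewrite !addn1 /= addn2 in n3 F2 FK; have [] := bare_ineq_one_two n3.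
rewrite -F2; lia.
Qed.

Lemma take_nseqS n (x : nat) : take n (x :: nseq n x) = nseq n x.
Proof. by elim: n => //= n ->. Qed.

Lemma nth_nseqS n (x : nat) : nth 0 (x :: nseq n x) n = x.
Proof. by elim: n. Qed.

Theorem theorem4 (T : finType) (E : {set {set T}}) (l : seq nat) :
  simple_graph E -> unicyclic E -> segseq E l -> nth 0 l 0 <= 2 ->
  (nth 0 l 0 = 2 -> 4 <= size l ->
     nsub E <= nsub (Ugraph (nth 0 l 0) (nth 0 l 1)
                       (take (size l - 3) (drop 2 l))
                       [:: nth 0 l (size l).-1])) /\
  (nth 0 l 0 = 1 -> 6 <= size l -> nsub E <= nsub (U1 (size l))).
Proof.
move=> simpE uE ssl l2.
have [l0|l0] := posnP (nth 0 l 0); first by rewrite l0.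
have [sl [Fs [UFs memFs pl]]] := ssl.
have short F : is_segment E F -> #|F| <= 2.
  move/memFs/(map_f (fun F : {set {set T}} => #|F|)); rewrite -(perm_mem pl) => Fl.
  apply: leq_trans l2; case: l {pl ssl l0} sl Fl => // x l /=.
  rewrite path_sortedE => [/andP[/allP xl _]|]; last exact/rev_trans/leq_trans.
  by rewrite inE => /orP[/eqP->|/xl].
have exF : exists F, is_segment E F.
  case: Fs UFs memFs pl => [|F Fs] _ memFs pl; last first.
    by exists F; apply/memFs; rewrite mem_head.
  by move/perm_size: pl l0 => /size0nil->.
have Dind := deg2_indep simpE (proj1 uE) exF short.
have lE := segseq_shape simpE Dind short ssl.
have [c1 [c2 [F [K [a [b [ct oE dE bnd]]]]]]] := unicyclic_bound simpE uE Dind.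
set o := #|free_edges E| in lE oE; set d := #|D2set E| in lE dE.
have sz : size l = d + o by rewrite lE size_cat !size_nseq.
split=> [h2 m4|h1 m6]; last first.
  have d0 : d = 0 by case: (d) lE h1 => // d' ->.
  have D0 : D2set E = set0 by apply/eqP; rewrite -cards_eq0 -/d d0.
  have [c [F' [K' [a' [cas o_a bnd']]]]] := unicyclic_bound_free simpE uE D0.
  apply: leq_trans bnd' _; rewrite sz d0 add0n /o o_a.
  (* The triangle with three pendent edges is the core of [U1] and gives equality. *)
  case: cas => [[-> -> ->]|[-> -> ->]|[c5 F2 FK]].
  - have -> : 6 + a' = a'.+1 + 5 by lia.
    by rewrite nsub_U1 expnS; lia.
  - have -> : 6 + a' = a'.+1 + 5 by lia.
    by rewrite nsub_U1 expnS; lia.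
  - have [i1 i2] := bare_ineq_free c5.
    have h := @scale_ineq 32 F' (17 * 2 ^ c) K' (32 * (5 + c)) (2 ^ a').
    have {}h : 32 * (F' * 2 ^ a' + K') <= 17 * 2 ^ c * 2 ^ a' + 32 * (5 + c).
      by apply: h; rewrite ?expn_gt0 // ?FK // -F2 in i1 *; lia.
    have -> : c + a' = (c - 5 + a') + 5 by lia.
    rewrite nsub_U1; move: h; rewrite -mulnA -expnD.
    have -> : c + a' = (c - 5 + a') + 5 by lia.
    by rewrite expnD; lia.
have d_gt0 : 0 < d by case: (d) lE h2 => // ->; case: (o).
apply: leq_trans bnd _; rewrite h2.
have bp : 0 < 2 ^ a * 3 ^ b by rewrite muln_gt0 !expn_gt0.
(* The extremal core depends on [l_2] and [l_m]: a triangle if only one segment has length 2,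
   otherwise a 4-cycle, whose last pendent path has length 2 exactly when all segments do. *)
case: (ltnP 1 d) => d1; last first.
  have d1' : d = 1 by lia.
  have [y oy] : exists y, o = y.+2 by exists o.-2; lia.
  rewrite lE d1' oy /= size_nseq !subSS subn0 nth_nseqS take_nseqS.
  have /= -> := @Ugraph_value 0 y 1 1 isT isT; rewrite mul1n.
  have [i1 i2] := core_ineq_one ct (etrans (esym dE) d1').
  have := scale_ineq i1 i2 (expn_gt0 2 a : 0 < 2 ^ a).
  have -> : 10 * 2 ^ c1 * 2 ^ a = 10 * 2 ^ y.+2 by rewrite -mulnA -expnD -oE oy.
  rewrite !expnS; lia.
have [x dx] : exists x, d = x.+2 by exists d.-2; lia.
case: (posnP o) => o0.
  have [x' xx] : exists x', x = x'.+1 by exists x.-1; lia.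
  rewrite lE dx xx o0 cats0 /= size_nseq !subSS subn0 nth_nseqS take_nseqS.
  have := @Ugraph_value x' 0 2 2 isT isT; rewrite cats0 /= => ->; rewrite muln1.
  have c10 : c1 = 0 by lia.
  have a0 : a = 0 by lia.
  rewrite {}c10 in ct; have [i1 i2] := core_ineq_twos ct.
  have := scale_ineq i1 i2 (expn_gt0 3 b : 0 < 3 ^ b).
  have -> : 22 * 3 ^ c2 * 3 ^ b = 22 * 3 ^ x'.+3 by rewrite -mulnA -expnD -dE dx xx.
  rewrite a0 !expnS; lia.
have [y oy] : exists y, o = y.+1 by exists o.-1; lia.
rewrite lE dx oy; have lastE : nseq x.+2 2 ++ nseq y.+1 1 = rcons (nseq x.+2 2 ++ nseq y 1) 1.
  by rewrite rcons_cat; congr (_ ++ _); elim: (y) => //= n ->.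
have -> : nth 0 (nseq x.+2 2 ++ nseq y.+1 1) (size (nseq x.+2 2 ++ nseq y.+1 1)).-1 = 1.
  by rewrite lastE size_rcons nth_rcons ltnn eqxx.
have -> : take (size (nseq x.+2 2 ++ nseq y.+1 1) - 3) (drop 2 (nseq x.+2 2 ++ nseq y.+1 1))
          = nseq x 2 ++ nseq y 1.
  rewrite lastE size_rcons /= drop0 -cats1 take_size_cat // size_cat !size_nseq; lia.
have /= -> := @Ugraph_value x y 2 1 isT isT.
have [i1 i2] := core_ineq ct; have := scale_ineq i1 i2 bp.
have -> : 8 * (2 ^ c1 * 3 ^ c2) * (2 ^ a * 3 ^ b) = 8 * (2 ^ (c1 + a) * 3 ^ (c2 + b)).
  by rewrite !expnD; lia.
rewrite -oE -dE oy dx !expnS mulnA; lia.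
Qed.
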